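(* Let $a>0$, $B>\frac{1}{2a}$, and let $u$ be a u.l.m. point process on $\mathbb{R}$. If there exists a point process $u'$ supported on $a\mathbb{Z}$ that mimics $u$ at the bandwidth $[-B,B]$, then for every $n\ge 1$ the $n$-level correlation measure of $u'$ (which is supported on $(a\mathbb{Z})^n$) is uniquely determined. That is, if $u'$ and $u''$ are two point processes supported on $a\mathbb{Z}$ that both mimic $u$ at the bandwidth $[-B,B]$, then $u'$ and $u''$ have the same $n$-level correlation measure for every $n\ge 1$.
   Context: A configuration in $\mathbb{R}$ is a locally finite countable (possibly finite or empty) family $u=(u_j)_j$ of real numbers, repetitions allowed and counted with multiplicity (the labelling is irrelevant). For $V\subset\mathbb{R}$ put $\#_V(u)=\#\{j: u_j\in V\}$. A point process on $\mathbb{R}$ is a random configuration, measurable with respect to the $\sigma$-algebra generated by the sets $\{u:\#_V(u)=m\}$ with $V$ a bounded Borel set and $m\ge 0$ an integer. It is supported on $a\mathbb{Z}=\{aj: j\in\mathbb{Z}\}$ if all its points lie in $a\mathbb{Z}$. A point process is u.l.m. (has uniform local moments) if for each $n\ge1$ there is $C_n<\infty$ with $\mathbb{E}[(\#_{[L,L+1]}(u))^n]\le C_n$ for all $L\in\mathbb{R}$. For a u.l.m. point process $u$ and $n\ge 1$, the $n$-level correlation measure $\rho_n$ is the unique Borel measure on $\mathbb{R}^n$ with $\mathbb{E}\sum_{j_1,\dots,j_n\ \text{distinct}}\phi(u_{j_1},\dots,u_{j_n})=\int_{\mathbb{R}^n}\phi\,d\rho_n$ for all $\phi\in C_c(\mathbb{R}^n)$.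 Fourier transform: $\hat\eta(\xi)=\int_{\mathbb{R}^n}\eta(x)e^{-2\pi i x\cdot\xi}\,dx$. $\mathcal{S}(\mathbb{R}^n)$ is the Schwartz class. For u.l.m. point processes $u,v$ on $\mathbb{R}$ and $B>0$, $v$ mimics $u$ at the bandwidth $[-B,B]$ (equivalently, at bandwidth $B$) if for each $n\ge1$ and all $\eta\in\mathcal{S}(\mathbb{R}^n)$ with $\hat\eta$ supported in $[-B,B]^n$, $\mathbb{E}\sum_{j_1,\dots,j_n\ \text{distinct}}\eta(u_{j_1},\dots,u_{j_n})=\mathbb{E}\sum_{j_1,\dots,j_n\ \text{distinct}}\eta(v_{j_1},\dots,v_{j_n})$. In particular a mimicking process is always u.l.m. *)

(* Defs.v *)
From HB Require Import structures.
From mathcomp Require Import all_boot all_order all_algebra finmap.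
From mathcomp Require Import all_classical all_reals all_analysis.
From mathcomp Require Export complex.

Set Implicit Arguments.
Unset Strict Implicit.
Unset Printing Implicit Defensive.
Import Order.TTheory GRing.Theory Num.Theory.
Import numFieldNormedType.Exports.

Local Open Scope classical_set_scope.
Local Open Scope ring_scope.

(* Re and Im on R[i], rather than those of numClosedFieldType. *)
Local Notation Re := complex.Re.
Local Notation Im := complex.Im.

(* A family (u_j)_j with j ranging over [labels], a set of natural numbers;
   [points] is meaningless off [labels]. *)
Record configuration (R : realType) := Configuration {
  labels : set nat ;
  points : nat -> R ;
  locally_finite : forall V : set R, bounded_set V ->
    finite_set (labels `&` points @^-1` V)
}.

Definition empty_configuration (R : realType) : configuration R :=
  @Configuration R set0 (fun=> 0)
    (fun V _ => eq_ind_r _ (finite_set0 nat) (set0I (_ @^-1` V))).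

HB.instance Definition _ (R : realType) := gen_eqMixin (configuration R).
HB.instance Definition _ (R : realType) := gen_choiceMixin (configuration R).
HB.instance Definition _ (R : realType) :=
  isPointed.Build (configuration R) (empty_configuration R).

(* #_V(c), to be used for bounded V only: it is 0 when infinitely many points
   lie in V. *)
Definition npoints (R : realType) (V : set R) (c : configuration R) : nat :=
  #|` fset_set (labels c `&` points c @^-1` V)|.

Definition count_events (R : realType) : set (set (configuration R)) :=
  [set E | exists (V : set R) (m : nat), [/\ measurable V, bounded_set V &
                           E = [set c | npoints V c = m]]].

Definition config_space (R : realType) := g_sigma_algebraType (@count_events R).

(* All random configurations below are {RV P >-> config_space R}. *)

Definition supported_on_lattice (R : realType) d (T : measurableType d)
    (P : probability T R) (a : R) (u : {RV P >-> config_space R}) : Prop :=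
  {ae P, forall w, forall j, labels (u w) j ->
    exists k : int, points (u w) j = a * k%:~R}.

Definition ulm (R : realType) d (T : measurableType d)
    (P : probability T R) (u : {RV P >-> config_space R}) : Prop :=
  forall n : nat, (0 < n)%N -> exists C : R, forall L : R,
    let X (w : T) : R := (npoints `[L, L + 1] (u w))%:R ^+ n in
    ('E_P[X] <= C%:E)%E.

(* Injective {ffun 'I_n -> nat} are the n-tuples of distinct labels. *)
Definition distinct_labels (R : realType) (c : configuration R) (n : nat) :
    set {ffun 'I_n -> nat} :=
  [set j : {ffun 'I_n -> nat} | injective j /\ forall i, labels c (j i)].
Arguments distinct_labels {R} c n _.

(* The sum of f(u_{j_1}, ..., u_{j_n}) over distinct j_1, ..., j_n: esum only
   makes sense for nonnegative terms, whence the splitting. The value is the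
   usual one as soon as the sum converges absolutely. *)
Definition distinct_sum (R : realType) (n : nat) (f : 'rV[R]_n -> R)
    (c : configuration R) : \bar R :=
  let g (j : {ffun 'I_n -> nat}) := (f (\row_i points c (j i)))%:E in
  (esum (distinct_labels c n) (g^\+) - esum (distinct_labels c n) (g^\-))%E.

Definition Edistinct_sum (R : realType) d (T : measurableType d)
    (P : probability T R) (u : {RV P >-> config_space R})
    (n : nat) (f : 'rV[R]_n -> R) : \bar R :=
  (\int[P]_w distinct_sum f (u w))%E.

Definition closed_support (T : topologicalType) (V : zmodType) (f : T -> V) :
    set T :=
  closure [set x | f x != 0].

Definition borel_rV (R : realType) (n : nat) :=
  g_sigma_algebraType (@open 'rV[R]_n).

Definition correlation_identity (R : realType) d (T : measurableType d)
    (P : probability T R) (u : {RV P >-> config_space R}) (n : nat)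
    (rho : {measure set (borel_rV R n) -> \bar R}) : Prop :=
  forall phi : 'rV[R]_n -> R, continuous phi -> compact (closed_support phi) ->
    Edistinct_sum u phi = (\int[rho]_x (phi x)%:E)%E.

(* Uniqueness is stated on Borel sets: the values of a measure on
   non-measurable sets are irrelevant. *)
Definition correlation_measure (R : realType) d (T : measurableType d)
    (P : probability T R) (u : {RV P >-> config_space R}) (n : nat)
    (rho : {measure set (borel_rV R n) -> \bar R}) : Prop :=
  correlation_identity u rho /\
  forall rho' : {measure set (borel_rV R n) -> \bar R},
    correlation_identity u rho' ->
    forall A, measurable A -> rho' A = rho A.

Definition lattice_rV (R : realType) (a : R) (n : nat) : set (borel_rV R n) :=
  [set x : 'rV[R]_n | forall i, exists k : int, x 0 i = a * k%:~R].
Arguments lattice_rV {R} a n _.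

(* Lebesgue measure on R^n as an iterated product, R^n.+1 being R * R^n. *)
Definition cons_rV (R : realType) (n : nat) (p : R * borel_rV R n) :
    borel_rV R n.+1 :=
  row_mx (p.1)%:M (p.2 : 'rV[R]_n) : 'rV[R]_(1 + n).

Fixpoint lebesgue_rV (R : realType) (n : nat) : set (borel_rV R n) -> \bar R :=
  match n with
  | 0 => dirac ((0 : 'rV[R]_0) : borel_rV R 0)
  | m.+1 => pushforward (lebesgue_measure \x @lebesgue_rV R m)%E
              (@cons_rV R m)
  end.

Definition fourier (R : realType) (n : nat) (eta : 'rV[R]_n -> R[i])
    (xi : 'rV[R]_n) : R[i] :=
  let t (x : 'rV[R]_n) : R := - (2 * pi * \sum_i x 0 i * xi 0 i) in
  let g x : R[i] := eta x * (cos (t x) +i* sin (t x))%C in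
  (fine (\int[@lebesgue_rV R n]_x (Re (g x))%:E)
   +i* fine (\int[@lebesgue_rV R n]_x (Im (g x))%:E))%C.

Definition partials (R : realType) (n : nat) (s : seq 'I_n)
    (f : 'rV[R]_n -> R) : 'rV[R]_n -> R :=
  foldr (fun i g => 'D_(delta_mx 0 i) g) f s.

Definition schwartz_real (R : realType) (n : nat) (f : 'rV[R]_n -> R) : Prop :=
  (forall s x, differentiable (partials s f) x) /\
  (forall (s : seq 'I_n) (k : 'I_n -> nat), exists C : R, forall x : 'rV[R]_n,
     `|(\prod_i x 0 i ^+ k i) * partials s f x| <= C).

Definition schwartz (R : realType) (n : nat) (eta : 'rV[R]_n -> R[i]) : Prop :=
  schwartz_real (fun x => Re (eta x)) /\ schwartz_real (fun x => Im (eta x)).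

(* The equality of the two complex expectations is stated componentwise. *)
Definition mimics (R : realType) d (T : measurableType d)
    d' (T' : measurableType d') (P : probability T R) (P' : probability T' R)
    (B : R) (v : {RV P' >-> config_space R}) (u : {RV P >-> config_space R}) :
    Prop :=
  [/\ ulm u, ulm v &
    forall (n : nat) (eta : 'rV[R]_n -> R[i]), (0 < n)%N -> schwartz eta ->
      closed_support (fourier eta) `<=`
        [set xi | forall i, - B <= xi 0 i <= B] ->
      Edistinct_sum u (fun x => Re (eta x)) =
        Edistinct_sum v (fun x => Re (eta x)) /\
      Edistinct_sum u (fun x => Im (eta x)) =
        Edistinct_sum v (fun x => Im (eta x))].

(* Main.v *)
(** A process supported on [a Z] is tested against
    [eta (x) = prod_i h (x_i - a k_i)], where [h] is a Schwartz function with
    [h 0 <> 0], [h (a j) = 0] for integers [j <> 0], and Fourier transform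
    supported in [[-B, B]]. Such an [h] exists because [B > 1 / (2 a)]: if
    [theta] is a smooth step with transition in a short interval around [0] and
    [c = 1 / (2 a)], then [g (t) = theta (t + c) - theta (t - c)] is smooth,
    supported in [[-B, B]], and its translates by [1 / a] add up to a constant,
    so that its inverse Fourier transform [h] vanishes on [a Z] outside [0].
    The expectation of the distinct sum of [eta] is [C = (h 0)^n] times the mean
    number [c_k] of [n]-tuples of distinct labels located at
    [(a k_1, ..., a k_n)]. Mimicking therefore determines every [c_k], and the
    correlation measure is [sum_k c_k delta_(a k)]. *)

From HB Require Import structures.
Require Import Defs.
From mathcomp Require Import finmap.
From mathcomp Require Import all_boot all_order all_algebra.
From mathcomp Require Import all_classical all_reals all_analysis.
From mathcomp Require Import measurable_realfun zify ring lra.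

Set Implicit Arguments.
Unset Strict Implicit.
Unset Printing Implicit Defensive.
Import Order.TTheory GRing.Theory Num.Theory.
Import numFieldNormedType.Exports.

Local Open Scope classical_set_scope.
Local Open Scope ring_scope.

(** * Smooth functions and a band-limited sampling function *)

(** Two obstacles shape the argument. The first is the support of the Fourier transform. The test
    function is defined as an integral of sines and cosines over [[-B, B]], and proving the support
    condition by Fourier inversion is avoided: the transform only has to vanish at frequencies
    beyond [B], and there [band_fourier0] gives an explicit primitive of the integrand that tends to
    0 at both infinities. Inside the band the transform is never computed. The second obstacle is
    measurability. The sigma-algebra on configurations sees occupation numbers and not labels, and
    the points lie on the lattice only almost surely. Sums over distinct labels are therefore
    rewritten, off a null set, as series over lattice sites whose terms depend on the occupation
    numbers alone. The moment bounds enter through the finiteness of the mean counts, without which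
    the factor [C] could not be cancelled in the extended reals. Since a correlation measure carries
    its own uniqueness clause, the final part also shows that integrals of compactly supported
    continuous functions determine a measure that is finite on balls. *)

(* A function is smooth when it belongs to a set of differentiable functions
   closed under differentiation; closure properties then need no bookkeeping of
   higher derivatives. *)
Definition smooth (R : realType) (g : R -> R) := exists S : set (R -> R),
  S g /\ forall h, S h -> exists2 h', S h' & forall t : R, is_derive t 1 h (h' t).

Section smooth.
Context {R : realType}.
Implicit Types (f g h : R -> R) (S : set (R -> R)) (c t : R).

Lemma smooth_derive g : smooth g ->
  exists2 g', smooth g' & forall t, is_derive t 1 g (g' t).
Proof.
move=> [S [Sg HS]]; have [g' Sg' gg'] := HS _ Sg.
by exists g' => //; exists S.
Qed.

Lemma is_derive_continuous g (d : R) t : is_derive t 1 g d -> {for t, continuous g}.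
Proof. by move=> [dg _]; apply/differentiable_continuous/derivable1_diffP. Qed.

Lemma smooth_continuous g : smooth g -> continuous g.
Proof.
by move=> /smooth_derive[g' _ gg'] t; exact: is_derive_continuous (gg' t).
Qed.

Lemma smooth_cst c : smooth (fun=> c).
Proof.
exists [set h | exists d, h = fun=> d]; split; first by exists c.
by move=> _ [d ->]; exists (fun=> 0); [exists 0|move=> t; exact: is_derive_cst].
Qed.

Lemma smooth_id : smooth (fun t => t).
Proof.
exists [set h | h = id \/ smooth h]; split; first by left.
move=> h [->|/smooth_derive[h' sh' hh']]; last by exists h' => //; right.
by exists (fun=> 1); [right; exact: smooth_cst|move=> t; exact: is_derive_id].
Qed.

Lemma smoothD f g : smooth f -> smooth g -> smooth (fun t => f t + g t).
Proof.
move=> sf sg.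
exists [set h | exists f g, [/\ smooth f, smooth g & h = f \+ g]].
split; first by exists f, g.
move=> _ [f1 [g1 [/smooth_derive[f1' sf1 df1] /smooth_derive[g1' sg1 dg1] ->]]].
by exists (f1' \+ g1'); [exists f1', g1'|move=> t; exact: is_deriveD].
Qed.

(** The Leibniz rule turns a product into a sum of two products, so a family closed under
    differentiation has to contain such sums. *)
Inductive sumprod : set (R -> R) :=
| sumprod_mul f g : smooth f -> smooth g -> sumprod (f * g)
| sumprod_add f g : sumprod f -> sumprod g -> sumprod (f + g).

Lemma smoothM f g : smooth f -> smooth g -> smooth (fun t => f t * g t).
Proof.
move=> sf sg; exists sumprod; split; first exact: sumprod_mul.
move=> h; elim => {h}.
- move=> f1 g1 sf1 sg1.
  have [f' sf' df] := smooth_derive sf1; have [g' sg' dg] := smooth_derive sg1.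
  exists (f1 * g' + g1 * f'); first by apply: sumprod_add; exact: sumprod_mul.
  by move=> t; apply: is_deriveM.
- move=> f1 g1 _ [f' sf' df] _ [g' sg' dg].
  exists (f' + g'); first exact: sumprod_add.
  by move=> t; apply: is_deriveD.
Qed.

Lemma smoothZ c g : smooth g -> smooth (fun t => c * g t).
Proof. by move=> sg; apply: smoothM => //; exact: smooth_cst. Qed.

Lemma smoothN g : smooth g -> smooth (fun t => - g t).
Proof.
move=> /(smoothZ (- 1)); rewrite (_ : (fun t => -1 * g t) = fun t => - g t)//.
by apply/funext => t; rewrite mulN1r.
Qed.

Lemma is_derive_affine a c t : is_derive t 1 (fun s => a * s + c) a.
Proof.
have -> : (fun s => a * s + c) = (a *: (id : R -> R)) + cst c :> (R -> R) by [].
by apply: is_derive_eq; rewrite addr0 [LHS]mulr1.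
Qed.

Lemma is_derive_comp_affine g (d a c t : R) : is_derive (a * t + c) 1 g d ->
  is_derive t 1 (fun s => g (a * s + c)) (d * a).
Proof.
move=> dg; have da := is_derive_affine a c t.
exact: (@is_derive1_comp _ g (fun s => a * s + c)).
Qed.

Lemma smooth_comp_affine a c g : smooth g -> smooth (fun t => g (a * t + c)).
Proof.
move=> sg; exists [set h | exists d f, smooth f /\ h = fun t => d * f (a * t + c)].
split.
  by exists 1, g; split => //; apply/funext => t; rewrite mul1r.
move=> _ [d [f [/smooth_derive[f' sf' df] ->]]].
exists (fun t => (d * a) * f' (a * t + c)); first by exists (d * a), f'.
move=> t; have dft := is_derive_comp_affine (df (a * t + c)).
have -> : (fun t => d * f (a * t + c)) =
    (d *: (fun t => f (a * t + c)) : R -> R) by [].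
by apply: is_derive_eq; rewrite /GRing.scale/=; ring.
Qed.

Lemma smooth_cos c : smooth (fun t => cos (c * t)).
Proof.
have : smooth (@cos R).
  exists [set h | exists a b, h = fun t => a * cos t + b * sin t]; split.
    by exists 1, 0; apply/funext => t; rewrite mul0r addr0 mul1r.
  move=> _ [a [b ->]]; exists (fun t => b * cos t + (- a) * sin t).
    by exists b, (- a).
  move=> t.
  have da : is_derive t 1 (a *: @cos R) (a *: - sin t) by apply: is_deriveZ.
  have db : is_derive t 1 (b *: @sin R) (b *: cos t) by apply: is_deriveZ.
  have := is_deriveD da db; congr is_derive.
  by rewrite -[LHS]/(a * - sin t + b * cos t) mulrN mulNr addrC.
by move=> /(@smooth_comp_affine c 0); congr smooth; apply/funext => t; rewrite addr0.
Qed.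

Lemma smooth_sin c : smooth (fun t => sin (c * t)).
Proof.
have : smooth (@sin R).
  have /(@smooth_comp_affine 1 (- (pi / 2))) := smooth_cos 1; congr smooth.
  by apply/funext => t; rewrite !mul1r cosBpihalf.
by move=> /(@smooth_comp_affine c 0); congr smooth; apply/funext => t; rewrite addr0.
Qed.

Lemma smooth_primitive f g : smooth g -> (forall t, is_derive t 1 f (g t)) -> smooth f.
Proof.
move=> sg dfg; exists [set h | h = f \/ smooth h]; split; first by left.
move=> h [->|/smooth_derive[h' sh' hh']]; last by exists h' => //; right.
by exists g; [right|].
Qed.

End smooth.

(** * Flat exponentials and bump functions *)

Section exp_inv.
Context {R : realType}.
Implicit Types (t : R).

(** For [m = 0] this is the classical flat function at the origin. The powers of [1 / t] are
    included because its derivatives produce them. *)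
Definition exp_inv (m : nat) (t : R) : R :=
  if 0 < t then (t^-1) ^+ m * expR (- t^-1) else 0.

(** The exponential dominates one term of its series, [y ^ (m + 2) / (m + 2)!] at [y = 1 / t]. The
    two extra powers make the difference quotient at the origin of order [t], so the derivative
    there exists and is 0. *)
Lemma exp_inv_le m t : `|exp_inv m t| <= (m.+2)`!%:R * t ^+ 2.
Proof.
rewrite /exp_inv; case: ifPn => [t0|_]; last first.
  by rewrite normr0 mulr_ge0 ?ler0n ?sqr_ge0.
have y0 : 0 <= t^-1 by rewrite invr_ge0 ltW.
rewrite ger0_norm ?mulr_ge0 ?exprn_ge0 ?expR_ge0// expRN ler_pdivrMr ?expR_gt0//.
have := expR_ge1Dxn m.+1 y0; set e := expR _ => he.
have ft : 0 < (m.+2)`!%:R :> R by rewrite ltr0n fact_gt0.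
have : t^-1 ^+ m.+2 / (m.+2)`!%:R <= e by lra.
rewrite ler_pdivrMr// => /(ler_wpM2r (sqr_ge0 t)).
have -> : t^-1 ^+ m.+2 * t ^+ 2 = t^-1 ^+ m.
  by rewrite -addn2 exprD -mulrA -[X in _ * X]exprMn mulVf ?gt_eqF// expr1n mulr1.
by have -> : e * (m.+2)`!%:R * t ^+ 2 = (m.+2)`!%:R * t ^+ 2 * e by ring.
Qed.

(** The derivative of [exp_inv m] combines [exp_inv m.+1] and [exp_inv m.+2], so the linear span is
    closed under differentiation and witnesses smoothness. *)
Inductive exp_inv_span : set (R -> R) :=
| exp_inv_span0 : exp_inv_span (fun=> 0)
| exp_inv_spanD a m f : exp_inv_span f ->
    exp_inv_span (a *: exp_inv m + f).

Lemma is_derive_exp_inv m t :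
  is_derive t 1 (exp_inv m) (- m%:R * exp_inv m.+1 t + exp_inv m.+2 t).
Proof.
have [t0|t0|t0] := ltgtP 0 t.
- apply: (@near_eq_is_derive _ _ _ (fun t => (t^-1) ^+ m * expR (- t^-1))).
    near=> s; rewrite /exp_inv ifT//.
    by near: s; exact: lt_nbhsr.
  have dV : is_derive t 1 (fun s : R => s^-1) (- t ^- 2 *: 1).
    by apply: (@is_deriveV _ id); rewrite ?gt_eqF.
  have -> : (fun s : R => (s^-1) ^+ m * expR (- s^-1)) =
    ((fun s : R => s^-1) ^+ m) * (expR \o (- (fun s : R => s^-1))).
    by apply/funext => s; rewrite /= -[RHS]/(_ * _) exprfctE.
  have dE : is_derive t 1 (expR \o (- (fun s : R => s^-1)))
     (expR (- t^-1) * (t ^- 2)).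
    apply: is_derive1_comp.
    by apply: is_derive_eq; rewrite /GRing.scale/= mulr1 opprK.
  case: m => [|m].
    rewrite expr0; apply: is_derive_eq.
    rewrite /exp_inv t0 /GRing.scale/=; rewrite mulr0 addr0 [LHS]mul1r; field;
      exact: lt0r_neq0.
  apply: is_derive_eq; rewrite /exp_inv t0 /GRing.scale/= exprfctE.
  rewrite -[(- _) t]/(- t^-1) !exprS; field.
  exact: lt0r_neq0.
- rewrite /exp_inv !ifN -?leNgt 1?ltW// mulr0 addr0.
  apply: (@near_eq_is_derive _ _ _ (fun=> 0)).
    near=> s; rewrite ifN// -leNgt ltW//.
    by near: s; exact: lt_nbhsl.
- rewrite -t0.
  have -> : - m%:R * exp_inv m.+1 0 + exp_inv m.+2 0 = 0.
    by rewrite /exp_inv ltxx mulr0 addr0.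
  have H : (fun h : R => h^-1 *: (exp_inv m (h *: 1 + 0) - exp_inv m 0)) @ 0^' --> (0 : R).
    apply/cvgrPdist_le => e e0.
    have C0 : 0 < (m.+2)`!%:R :> R by rewrite ltr0n fact_gt0.
    near=> h.
    have h0 : h != 0 by near: h; exact: nbhs_dnbhs_neq.
    rewrite sub0r normrN /exp_inv ltxx subr0 -/(exp_inv m _) addr0 [h *: 1]mulr1.
    rewrite normrM normfV ler_pdivrMl ?normr_gt0//.
    apply: (le_trans (exp_inv_le m h)).
    rewrite -[h ^+ 2]real_normK ?num_real// expr2 mulrCA ler_wpM2l// mulrC -ler_pdivlMr//.
    near: h; apply: dnbhs0_le; exact: divr_gt0.
  by split; [apply/cvg_ex; exists 0|exact: cvg_lim H].
Unshelve. all: by end_near. Qed.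

Lemma smooth_exp_inv m : smooth (exp_inv m).
Proof.
exists exp_inv_span; split.
  have := exp_inv_spanD 1 m exp_inv_span0; congr exp_inv_span.
  by apply/funext => t; rewrite /= [LHS]addr0 [LHS]mul1r.
move=> h; elim => [|a k f _ [f' sf' df]].
  by exists (fun=> 0); [exact: exp_inv_span0|move=> t; exact: is_derive_cst].
exists ((- a * k%:R) *: exp_inv k.+1 + (a *: exp_inv k.+2 + f')).
  by do 2 apply: exp_inv_spanD.
move=> t; have dk := is_derive_exp_inv k t.
apply: is_derive_eq; rewrite /GRing.scale/=.
rewrite -[RHS]/(_ * _ + (_ * _ + _)); ring.
Qed.

Lemma exp_inv_gt0 m t : 0 < t -> 0 < exp_inv m t.
Proof. by move=> t0; rewrite /exp_inv t0 mulr_gt0 ?expR_gt0 ?exprn_gt0 ?invr_gt0. Qed.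

Lemma exp_inv_eq0 m t : t <= 0 -> exp_inv m t = 0.
Proof. by move=> t0; rewrite /exp_inv ltNge t0. Qed.

Lemma bump_exists (e : R) : 0 < e -> exists b : R -> R,
  [/\ smooth b, forall t, 0 <= b t, forall t, e <= `|t| -> b t = 0 &
      forall t, `|t| < e -> 0 < b t].
Proof.
move=> e0; exists (fun t => exp_inv 0 (1 * t + e) * exp_inv 0 (-1 * t + e)); split.
- by apply: smoothM; apply: smooth_comp_affine; exact: smooth_exp_inv.
- move=> t; apply: mulr_ge0.
  + by have [/exp_inv_eq0->//|/exp_inv_gt0/ltW] := leP (1 * t + e) 0.
  + by have [/exp_inv_eq0->//|/exp_inv_gt0/ltW] := leP (-1 * t + e) 0.
- move=> t; rewrite ler_normr => /orP[et|et].
  + by rewrite [X in _ * X]exp_inv_eq0 ?mulr0//; lra.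
  + by rewrite exp_inv_eq0 ?mul0r//; lra.
- by move=> t; rewrite ltr_norml => /andP[? ?]; apply: mulr_gt0; apply: exp_inv_gt0; lra.
Qed.

End exp_inv.

(** * Primitives and the sampling identity on the frequency side *)

Section primitives.
Context {R : realType}.
Notation mu := (@lebesgue_measure R).
Implicit Types (f g F G : R -> R) (a b t : R).

Lemma is_derive_continuousT F f : (forall t, is_derive t 1 F (f t)) -> continuous F.
Proof. by move=> dF t; exact: is_derive_continuous (dF t). Qed.

Lemma RintegralFTC F f a b : a < b -> continuous f ->
  (forall t, is_derive t 1 F (f t)) -> \int[mu]_(t in `[a, b]) f t = F b - F a.
Proof.
move=> ab cf dF; have cF := is_derive_continuousT dF.
rewrite /Rintegral (@continuous_FTC2 _ f F)//.
- exact: continuous_subspaceT.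
- split; first by move=> x _; have [] := dF x.
  + exact/cvg_at_right_filter/cF.
  + exact/cvg_at_left_filter/cF.
- by move=> x _; rewrite derive1E; have [_ ->] := dF x.
Qed.

Lemma left_primitive f (L : R) : continuous f -> (forall t, t < L -> f t = 0) ->
  exists F, (forall t, is_derive t 1 F (f t)) /\ (forall t, t < L -> F t = 0).
Proof.
(* Starting at [L - 1] instead of [L] adds nothing to the integral, but it puts every [t >= L]
   strictly to the right of the lower endpoint, as the fundamental theorem requires. *)
move=> cf f0; pose F x := \int[mu]_(t in `[L - 1, x]) f t.
have F0 t : t < L -> F t = 0.
  move=> tL; rewrite /F (@eq_Rintegral _ _ _ _ _ (fun=> 0)).
    by rewrite /Rintegral integral0.
  move=> s; rewrite inE/= in_itv/= => /andP[_ st].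
  by rewrite f0// (le_lt_trans st).
exists F; split => // t.
have [tL|tL] := ltP t L.
  rewrite f0//; apply: (@near_eq_is_derive _ _ _ (fun=> 0)) => //.
  by near=> s; rewrite F0//; near: s; exact: lt_nbhsl.
have cfit : mu.-integrable `[L - 1, t + 1] (EFin \o f).
  apply: continuous_compact_integrable; first exact: segment_compact.
  exact: continuous_subspaceT.
have t1 : t < t + 1 by rewrite ltrDl.
have Lt : L - 1 < t by lra.
have [dF F'f] := continuous_FTC1_closed t1 cfit Lt (cf t).
by split; [exact: dF|rewrite -derive1E; exact: F'f].
Unshelve. all: by end_near. Qed.

(** This evaluates a primitive without closed form on an interval where its derivative is explicit,
    by the mean value theorem for [F - G]. *)
Lemma eq_increment F G f g a b : a <= b ->
  (forall t, is_derive t 1 F (f t)) -> (forall t, is_derive t 1 G (g t)) ->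
  (forall t, a <= t <= b -> f t = g t) -> F b - F a = G b - G a.
Proof.
move=> ab dF dG fg.
have dFG t : is_derive t 1 (F - G) (f t - g t) by apply: is_deriveB.
have [] := @MVT_segment _ (F - G) (fun t => f t - g t) _ _ ab.
- apply: continuous_subspaceT => t; exact: is_derive_continuous (dFG t).
- move=> c; rewrite in_itv/= => /fg -> /eqP; rewrite subrr mul0r.
  rewrite -[(F - G) b]/(F b - G b) -[(F - G) a]/(F a - G a).
  by move/eqP => ?; lra.
Qed.

Lemma trigB2pi_int (k : int) t :
  cos (t - 2 * pi * k%:~R) = cos t /\ sin (t - 2 * pi * k%:~R) = sin t.
Proof.
have H (n : nat) (s : R) :
    cos (s + 2 * pi * n%:R) = cos s /\ sin (s + 2 * pi * n%:R) = sin s.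
  rewrite (_ : 2 * pi * n%:R = (pi *+ 2) *+ n); last by rewrite -mulr_natr mulr2n; ring.
  by rewrite !(periodicn (@cosD2pi R)) !(periodicn (@sinD2pi R)).
case: k => n.
  have [Hc Hs] := H n (t - 2 * pi * n%:R).
  by rewrite subrK in Hc Hs; rewrite Hc Hs.
by rewrite NegzE mulrNz mulrN opprK; exact: (H n.+1).
Qed.

(** The cosine [p] has period [2c = 1 / a]. If [V] is the primitive of [th (t + c) * p t] that
    vanishes far to the left, then [V t - V (t - 2c)] is a primitive of [g * p], and its increment
    over [[-B, B]] is [V B - V (B - 2c)]. On [[B - 2c, B]] the step [th (t + c)] has reached its
    final value [m], so the integral is [m] times that of [p] over a full period, which is 0 unless
    [k = 0]. *)
Lemma sampling_freq (a B : R) : 0 < a -> 1 / (2 * a) < B -> exists g (B0 : R),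
  [/\ smooth g, 0 < B0 < B, forall t, B0 <= `|t| -> g t = 0 &
   exists2 C : R, C != 0 & forall k : int,
     \int[mu]_(t in `[- B, B]) (g t * cos (2 * pi * (a * k%:~R) * t)) =
     if k == 0 then C else 0].
Proof.
move=> a0 hB; pose c := 1 / (2 * a).
have c0 : 0 < c by rewrite /c divr_gt0// mulr_gt0.
have c2a : a * (2 * c) = 1 by rewrite /c; field; rewrite gt_eqF.
(* The half-width of the transition. The bound [(B - c) / 2] keeps [c + e] below [B] and makes
   [th (t + c)] constant on [[B - 2c, B]]. *)
pose e := Num.min c ((B - c) / 2).
have e0 : 0 < e by rewrite /e lt_min c0 divr_gt0// subr_gt0.
have ec : e <= c by rewrite /e ge_min lexx.
have eB : e <= (B - c) / 2 by rewrite /e ge_min lexx orbT.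
have [b [sb b0 bout bin]] := bump_exists e0.
have [th [dth th0]] : exists th, (forall t, is_derive t 1 th (b t)) /\
    (forall t, t < - e -> th t = 0).
  apply: left_primitive; first exact: smooth_continuous.
  by move=> t te; apply: bout; rewrite ler_normr; apply/orP; right; lra.
have sth : smooth th by exact: smooth_primitive dth.
have th0' t : t <= - e -> th t = 0.
  rewrite le_eqVlt => /orP[/eqP ->|]; last exact: th0.
  have : th (- e) - th (- e - 1) = (fun=> 0) (- e) - (fun=> 0) (- e - 1) :> R.
    apply: (@eq_increment th (fun=> 0) b (fun=> 0)) => //; first by lra.
    by move=> s se; apply: bout; rewrite ler_normr; apply/orP; right; lra.
  by rewrite (th0 (- e - 1)) ?subr0//; lra.
pose m := th e.
have m0 : 0 < m.
  have [] := @MVT _ th b (- e) e _ (fun t _ => dth t).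
  - by lra.
  - exact/continuous_subspaceT/smooth_continuous.
  - move=> s; rewrite in_itv/= => /andP[s1 s2]; rewrite (th0' (- e)) ?subr0// -/m => ->.
    by apply: mulr_gt0; [apply: bin; rewrite ltr_norml s1|lra].
have thm t : e <= t -> th t = m.
  move=> et; have : th t - th e = (fun=> 0) t - (fun=> 0) e :> R.
    apply: (@eq_increment th (fun=> 0) b (fun=> 0)) => //.
    by move=> s se; apply: bout; rewrite ler_normr; apply/orP; left; lra.
  by rewrite subr0 => /eqP; rewrite subr_eq0 => /eqP.
pose g t := th (1 * t + c) + - th (1 * t + - c).
exists g, (c + e); split.
- apply: smoothD; first exact: smooth_comp_affine.
  by apply: smoothN; exact: smooth_comp_affine.
- by apply/andP; split; lra.
- move=> t; rewrite /g ler_normr !mul1r => /orP[ct|ct].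
  + by rewrite !thm ?subrr//; lra.
  + by rewrite !th0' ?subrr//; lra.
exists (m * (2 * c)); first by apply: lt0r_neq0; do 2 apply: mulr_gt0 => //.
move=> k; set kap := 2 * pi * _; pose p t := cos (kap * t).
have pper t : p (1 * t + - (2 * c)) = p t.
  rewrite /p -(trigB2pi_int k (kap * t)).1; congr cos.
  rewrite mul1r mulrDr mulrN; congr (_ - _).
  by rewrite /kap -[RHS]mulr1 -[X in _ = _ * X]c2a; ring.
have sp : smooth p by exact: smooth_cos.
have [V [dV V0]] : exists V, (forall t, is_derive t 1 V (th (1 * t + c) * p t)) /\
    (forall t, t < - (c + e) -> V t = 0).
  apply: left_primitive; first apply: smooth_continuous.
    by apply: smoothM => //; exact: smooth_comp_affine.
  by move=> t te; rewrite th0' ?mul0r//; lra.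
have sV : smooth V.
  apply: (@smooth_primitive _ V _ _ dV).
  by apply: smoothM => //; exact: smooth_comp_affine.
have dW t : is_derive t 1 (fun t => V t - V (1 * t + - (2 * c))) (g t * p t).
  have dVc : is_derive t 1 (fun t => V (1 * t + - (2 * c))) (th (1 * t - c) * p t).
    have := is_derive_comp_affine (dV (1 * t + - (2 * c))).
    rewrite mulr1 pper; congr is_derive; congr (th _ * _).
    by rewrite !mul1r; ring.
  rewrite (_ : g t * p t = th (1 * t + c) * p t - th (1 * t - c) * p t); last first.
    by rewrite /g mulrBl.
  exact: is_deriveB.
rewrite (RintegralFTC _ _ dW); last 2 first.
- by lra.
- by apply: smooth_continuous; apply: smoothM => //; apply: smoothD;
    [|apply: smoothN]; exact: smooth_comp_affine.
rewrite !mul1r (V0 (- B)); last by lra.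
rewrite (V0 (- B - _)); last by lra.
rewrite !subr0; have [k0|k0] := eqVneq k 0.
- have -> : V B - V (B - 2 * c) = (fun t => m * t) B - (fun t => m * t) (B - 2 * c).
    apply: (@eq_increment V (fun t => m * t) _ (fun=> m) _ _ _ dV).
    + by lra.
    + move=> t; rewrite (_ : (fun t => _) = m *: (id : R -> R))//.
      by apply: is_derive_eq; rewrite [LHS]mulr1.
    + move=> t tB; rewrite thm; last by lra.
      by rewrite /p /kap k0 mulr0z !(mulr0, mul0r) cos0 mulr1.
  by ring.
- have kap0 : kap != 0.
    have p0 := lt0r_neq0 (@pi_gt0 R); have a1 := lt0r_neq0 a0.
    by rewrite /kap !mulf_eq0 !negb_or intr_eq0 k0 pnatr_eq0 p0 a1.

  pose S t := m / kap * sin (kap * t).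
  have -> : V B - V (B - 2 * c) = S B - S (B - 2 * c).
    apply: (@eq_increment V S _ (fun t => m * p t) _ _ _ dV).
    + by lra.
    + move=> t; have ds := is_derive_comp_affine (is_derive_sin (kap * t + 0)).
      rewrite /S (_ : (fun t => _) = (m / kap) *: (fun t : R => sin (kap * t + 0))).
        by apply: is_derive_eq; rewrite /GRing.scale/= /p addr0; field.
      by apply/funext => s; rewrite -[RHS]/(m / kap * sin (kap * s + 0)) addr0.
    + by move=> t tB; rewrite thm//; lra.
  rewrite /S -(trigB2pi_int k (kap * B)).2.
  rewrite (_ : kap * B - _ = kap * (B - 2 * c)) ?subrr//.
  rewrite mulrBr; congr (_ - _).
  by rewrite /kap -[LHS]mulr1 -[X in _ * X = _]c2a; ring.
Qed.

End primitives.

(** * One-dimensional band-limited Schwartz functions *)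

Section whole_line.
Context {R : realType}.
Notation mu := (@lebesgue_measure R).
Implicit Types (f Q : R -> R) (C : R).

Lemma integrable_oneDsqrV : mu.-integrable setT (fun x : R => (oneDsqr x)^-1%:E).
Proof.
apply/integrableP; split.
  by apply/measurable_EFinP; apply: continuous_measurable_fun; exact: continuous_oneDsqrV.
under eq_integral do rewrite gee0_abs ?lee_fin ?invr_ge0 ?(ltW (oneDsqr_gt0 _))//.
rewrite ge0_symfun_integralT.
- rewrite -set_itvcy (integral0y_oneDsqr R).
  by rewrite -EFinM ltry.
- by move=> x; rewrite invr_ge0 ltW// oneDsqr_gt0.
- exact: continuous_oneDsqrV.
- by move=> x; rewrite /= /oneDsqr sqrrN.
Qed.

Lemma integrable_decay f C : continuous f -> (forall x, `|f x| * (1 + x ^+ 2) <= C) ->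
  mu.-integrable setT (EFin \o f).
Proof.
move=> cf fC.
apply: (le_integrable _ _ _ (integrableZl _ C integrable_oneDsqrV)) => //.
  by apply/measurable_EFinP; exact: continuous_measurable_fun.
move=> x _; rewrite /= lee_fin (le_trans _ (ler_norm _))//.
by rewrite ler_pdivlMr// oneDsqr_gt0.
Qed.

(** The bound on [x * Q x] forces [Q] to tend to 0 at both infinities; the fundamental theorem on
    growing symmetric segments and dominated convergence do the rest. *)
Lemma integralT_primitive f Q C : continuous f -> mu.-integrable setT (EFin \o f) ->
  (forall x : R, is_derive x 1 Q (f x)) -> (forall x, `|x * Q x| <= C) ->
  (\int[mu]_x (f x)%:E = 0)%E.
Proof.
move=> cf fint dQ QC.
pose A n : set R := [set` `[- n.+1%:R, n.+1%:R]].
pose f_ n (x : R) : \bar R := ((EFin \o f) \_ (A n)) x.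
have mA n : measurable (A n) by exact: measurable_itv.
have mf : measurable_fun setT (EFin \o f) by case/integrableP : fint.
have [|||_ _ H] := @dominated_convergence _ _ _ mu setT measurableT f_ (EFin \o f)
    (abse \o (EFin \o f)) _ mf _ (integrable_abse fint).
- by move=> n; have [+ _] := measurable_restrictT (EFin \o f) (mA n); apply;
    exact: measurable_funTS.
- apply/aeW => x _; apply: (@cvg_near_cst _ _ _ _ ).
  near=> n; rewrite /f_ patchE mem_set// /A /= in_itv/= -ler_norml.
  rewrite (@le_trans _ _ n%:R) ?ler_nat//.
  near: n; exact: nbhs_infty_ger.
- apply/aeW => x n _; rewrite /f_ patchE; case: ifPn => // _.
  by rewrite abse0 abse_ge0.
have {}H : (fun n => (\int[mu]_x f_ n x)%E) @ \oo --> (\int[mu]_x (f x)%:E)%E by exact: H.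
have E n : (\int[mu]_x f_ n x)%E = (Q n.+1%:R - Q (- n.+1%:R))%:E.
  rewrite /f_ -integral_mkcond (@continuous_FTC2 _ f Q) ?EFinB//.
  - by rewrite gtrN.
  - exact: continuous_subspaceT.
  - split; first by move=> x _; have [] := dQ x.
    + exact/cvg_at_right_filter/(is_derive_continuousT dQ).
    + exact/cvg_at_left_filter/(is_derive_continuousT dQ).
  - by move=> x _; rewrite derive1E; have [_ ->] := dQ x.
apply: (cvg_unique _ H) => //.
rewrite (_ : (fun n => _) = EFin \o (fun n => Q n.+1%:R - Q (- n.+1%:R))); last first.
  by apply/funext => n; rewrite E.
apply: cvg_EFin; first exact: nearW.
have C0 : 0 <= C by exact: le_trans (QC 0).
apply/cvgrPdist_le => e e0; near=> n.
have n0 : 0 < n.+1%:R :> R by rewrite ltr0n.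
have B s : `|s| = n.+1%:R -> `|Q s| <= e / 2.
  move=> sn; have := QC s; rewrite normrM sn -ler_pdivlMl// => /le_trans; apply.
  rewrite ler_pdivrMl// mulrC -ler_pdivrMl ?divr_gt0//.
  rewrite (@le_trans _ _ n%:R) ?ler_nat//.
  by near: n; exact: nbhs_infty_ger.
rewrite sub0r normrN (le_trans (ler_normB _ _))// [leRHS]splitr lerD// B//.
  by rewrite ger0_norm.
by rewrite normrN ger0_norm.
Unshelve. all: by end_near. Qed.

End whole_line.

(** * Trigonometric integrals over [[-B, B]] *)

Section trig_integral.
Context {R : realType}.
Notation mu := (@lebesgue_measure R).
Variable B : R.
Hypothesis B0 : 0 < B.
Implicit Types (g p : R -> R) (x t : R).

Local Notation cont g := {within `[- B, B], continuous g}.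

Definition trig_kernel g1 g2 x t :=
  g1 t * cos (2 * pi * x * t) + g2 t * sin (2 * pi * x * t).

(** For real densities this is the real part of the inverse Fourier transform of [g1 - i g2]
    restricted to [[-B, B]]. Carrying a cosine and a sine density allows differentiation,
    multiplication by [x] and translation without leaving real functions. *)
Definition trig_integral g1 g2 x := \int[mu]_(t in `[- B, B]) trig_kernel g1 g2 x t.

Lemma segment_contT g : continuous g -> cont g.
Proof. exact: continuous_subspaceT. Qed.

Lemma segment_contM g p : cont g -> cont p -> cont (fun t => g t * p t).
Proof. by move=> cg cp t; apply: continuousM; [exact: cg|exact: cp]. Qed.

Lemma segment_contD g p : cont g -> cont p -> cont (fun t => g t + p t).
Proof. by move=> cg cp t; apply: continuousD; [exact: cg|exact: cp]. Qed.

Lemma segment_contN g : cont g -> cont (fun t => - g t).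
Proof. by move=> cg t; apply: continuousN; exact: cg. Qed.

Lemma segment_contZ c g : cont g -> cont (fun t => c * g t).
Proof. by apply: segment_contM; apply: segment_contT => t; exact: cvg_cst. Qed.

Lemma segment_cont_id : cont (fun t => t).
Proof. by apply: segment_contT => t; exact: cvg_id. Qed.

Lemma segment_cont_norm g : cont g -> cont (fun t => `|g t|).
Proof. by move=> cg t; apply: continuous_comp; [exact: cg|exact: norm_continuous]. Qed.

Lemma segment_cont_kernel g1 g2 x : cont g1 -> cont g2 -> cont (trig_kernel g1 g2 x).
Proof.
move=> c1 c2; apply: segment_contD; apply: segment_contM => //; apply: segment_contT.
- exact/smooth_continuous/smooth_cos.
- exact/smooth_continuous/smooth_sin.
Qed.

Lemma segment_cont_integrable g : cont g -> mu.-integrable `[- B, B] (EFin \o g).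
Proof.
by move=> cg; apply: continuous_compact_integrable => //; exact: segment_compact.
Qed.

Hint Resolve segment_cont_kernel segment_cont_integrable : core.

Lemma eq_trig_integral g1 g2 p1 p2 x :
  (forall t, - B <= t <= B -> g1 t = p1 t) -> (forall t, - B <= t <= B -> g2 t = p2 t) ->
  trig_integral g1 g2 x = trig_integral p1 p2 x.
Proof.
move=> e1 e2; apply: eq_Rintegral => t; rewrite inE/= in_itv/= => tB.
by rewrite /trig_kernel e1// e2.
Qed.

Lemma trig_integral_lin c d g1 g2 p1 p2 x : cont g1 -> cont g2 -> cont p1 -> cont p2 ->
  c * trig_integral g1 g2 x + d * trig_integral p1 p2 x =
  trig_integral (fun t => c * g1 t + d * p1 t) (fun t => c * g2 t + d * p2 t) x.
Proof.
move=> cg1 cg2 cp1 cp2; rewrite /trig_integral -!RintegralZl//; try by auto.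
rewrite -RintegralD//; try by apply: segment_cont_integrable; apply: segment_contZ; auto.
by apply: eq_Rintegral => t _; rewrite /trig_kernel; ring.
Qed.

Lemma trig_kernel_le g1 g2 x t : `|trig_kernel g1 g2 x t| <= `|g1 t| + `|g2 t|.
Proof.
rewrite (le_trans (ler_normD _ _))// !normrM lerD//.
- by rewrite ler_piMr// ler_norml cos_geN1 cos_le1.
- by rewrite ler_piMr// ler_norml sin_geN1 sin_le1.
Qed.

Lemma trig_integral_bounded g1 g2 : cont g1 -> cont g2 ->
  exists C, forall x, `|trig_integral g1 g2 x| <= C.
Proof.
move=> c1 c2; exists (\int[mu]_(t in `[- B, B]) (`|g1 t| + `|g2 t|)) => x.
rewrite (le_trans (le_normr_Rintegral _ _))//; first by auto.
apply: le_Rintegral => //.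
- by apply: segment_cont_integrable; apply: segment_cont_norm; auto.
- by apply: segment_cont_integrable; apply: segment_contD; apply: segment_cont_norm.
- by move=> t _; exact: trig_kernel_le.
Qed.

Lemma is_derive_trig_kernel g1 g2 x t :
  is_derive x 1 (fun x => trig_kernel g1 g2 x t)
    (trig_kernel (fun t => 2 * pi * (t * g2 t)) (fun t => - (2 * pi * (t * g1 t))) x t).
Proof.
have dc := is_derive_comp_affine (is_derive_cos (2 * pi * t * x + 0)).
have ds := is_derive_comp_affine (is_derive_sin (2 * pi * t * x + 0)).
have dg1 := @is_deriveZ _ _ _ _ (g1 t) _ _ _ dc.
have dg2 := @is_deriveZ _ _ _ _ (g2 t) _ _ _ ds.
rewrite /trig_kernel (_ : (fun x => _) = g1 t *: (fun x => cos (2 * pi * t * x + 0)) +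
   g2 t *: (fun x => sin (2 * pi * t * x + 0))).
  have := is_deriveD dg1 dg2; congr is_derive.
  by rewrite /GRing.scale/= !addr0 (mulrAC _ t x); ring.
by apply/funext => y; rewrite mulrAC -[2 * pi * t * y]addr0.
Qed.

(** Differentiation under the integral sign: on the segment the factor [t] of the differentiated
    kernel is at most [B] in absolute value, so the dominating function does not depend on [x]. *)
Lemma is_derive_trig_integral g1 g2 x : cont g1 -> cont g2 ->
  is_derive x 1 (trig_integral g1 g2)
    (trig_integral (fun t => 2 * pi * (t * g2 t)) (fun t => - (2 * pi * (t * g1 t))) x).
Proof.
move=> c1 c2.
have dE y t : partial1of2 (trig_kernel g1 g2) y t =
    trig_kernel (fun t => 2 * pi * (t * g2 t)) (fun t => - (2 * pi * (t * g1 t))) y t.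
  by rewrite partial1of2E; have [_ ->] := is_derive_trig_kernel g1 g2 y t.
have cG : cont (fun t => 2 * pi * B * (`|g1 t| + `|g2 t|)).
  by apply: segment_contZ; apply: segment_contD; apply: segment_cont_norm.
have pi2 : 0 <= 2 * pi :> R by rewrite mulr_ge0// pi_ge0.
have Ix : [set` `]x - 1, x + 1[] x by rewrite /= in_itv/= ltrBlDr ltrDl ltr01.
have intf y : [set` `]x - 1, x + 1[] y ->
  mu.-integrable `[- B, B] (EFin \o trig_kernel g1 g2 y) by auto.
have derf y t : [set` `]x - 1, x + 1[] y -> [set` `[- B, B]] t ->
  derivable ((trig_kernel g1 g2) ^~ t) y 1.
  by move=> _ _; have [] := is_derive_trig_kernel g1 g2 y t.
have G0 t : 0 <= 2 * pi * B * (`|g1 t| + `|g2 t|).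
  by rewrite mulr_ge0// ?addr_ge0// mulr_ge0// ltW.
have Gub y t : [set` `]x - 1, x + 1[] y -> [set` `[- B, B]] t ->
    `|partial1of2 (trig_kernel g1 g2) y t| <= 2 * pi * B * (`|g1 t| + `|g2 t|).
  move=> _; rewrite /= in_itv/= dE -ler_norml => tB.
  rewrite (le_trans (trig_kernel_le _ _ _ _))// normrN !normrM -!mulrDr.
  rewrite (ger0_norm (ler0n R 2)) (ger0_norm (@pi_ge0 R)) -!mulrA.
  do 2 rewrite ler_wpM2l ?pi_ge0//.
  by rewrite [ `|g2 t| + _]addrC ler_wpM2r// addr_ge0.
have mB : measurable [set` `[- B, B]] by exact: measurable_itv.
have H := @cvg_differentiation_under_integral R _ _ mu (trig_kernel g1 g2)
  _ mB x (x - 1) (x + 1) Ix intf derf _ G0 (segment_cont_integrable cG) Gub.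
have -> : trig_integral (fun t => 2 * pi * (t * g2 t)) (fun t => - (2 * pi * (t * g1 t))) x
    = \int[mu]_(t in `[- B, B]) partial1of2 (trig_kernel g1 g2) x t.
  by apply: eq_Rintegral => t _; rewrite dE.
have {}H : (fun h => h^-1 *: (trig_integral g1 g2 (h *: 1 +
  x) - trig_integral g1 g2 x)) @ 0^'
    --> \int[mu]_(t in `[- B, B]) partial1of2 (trig_kernel g1 g2) x t.
  by under eq_fun do rewrite [_ *: 1]mulr1; exact: H.
by split; [apply/cvg_ex; eexists; exact: H|exact: cvg_lim H].
Qed.

(** Integration by parts: [F] below has derivative [K] and vanishes at both endpoints.
    Differentiability is asked on the segment only, so that the densities may be divided by a
    function known to be nonzero just there. *)
Lemma mul_trig_integral g1 g2 g1' g2' x : cont g1' -> cont g2' ->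
  (forall t, - B <= t <= B -> is_derive t 1 g1 (g1' t)) ->
  (forall t, - B <= t <= B -> is_derive t 1 g2 (g2' t)) ->
  g1 B = 0 -> g1 (- B) = 0 -> g2 B = 0 -> g2 (- B) = 0 ->
  2 * pi * (x * trig_integral g1 g2 x) = trig_integral g2' (fun t => - g1' t) x.
Proof.
move=> c1' c2' d1 d2 g1B g1NB g2B g2NB.
have BB : - B <= B by rewrite ge0_cp// ltW.
have cder g g' : (forall t, - B <= t <= B -> is_derive t 1 g (g' t)) -> cont g.
  move=> dg; apply: derivable_within_continuous => t; rewrite in_itv/= => tB.
  by have [] := dg _ tB.
have c1 : cont g1 by exact: cder d1.
have c2 : cont g2 by exact: cder d2.
pose k := 2 * pi * x.
pose F t := g1 t * sin (k * t) - g2 t * cos (k * t).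
pose K t := k * trig_kernel g1 g2 x t + -1 * trig_kernel g2' (fun t => - g1' t) x t.
have dF t : - B <= t <= B -> is_derive t 1 F (K t).
  move=> tB; have d1t := d1 t tB; have d2t := d2 t tB.
  have dc := is_derive_comp_affine (is_derive_cos (k * t + 0)).
  have ds := is_derive_comp_affine (is_derive_sin (k * t + 0)).
  rewrite /F (_ : (fun t => _) = g1 * (fun t => sin (k * t + 0)) -
      g2 * (fun t => cos (k * t + 0))); last first.
    by apply/funext => s; rewrite -[k * s]addr0.
  apply: is_derive_eq; rewrite /GRing.scale/= !addr0 /K /trig_kernel -/k; ring.
have cK : cont K by apply: segment_contD; apply: segment_contZ;
  apply: segment_cont_kernel => //; exact: segment_contN.
have I : (\int[mu]_(t in `[(- B)%R, B]) (K t)%:E = (F B)%:E - (F (- B)%R)%:E)%E.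
  apply: continuous_FTC2 => //.
  - by rewrite gtrN.
  - split.
    + move=> t; rewrite in_itv/= => /andP[/ltW tB /ltW tB'].
      by have [] := dF t; rewrite // tB.
    + apply: cvg_at_right_filter; apply: is_derive_continuous; apply: dF.
      by rewrite lexx.
    + apply: cvg_at_left_filter; apply: is_derive_continuous; apply: dF.
      by rewrite lexx andbT.
  - move=> t; rewrite in_itv/= => /andP[/ltW tB /ltW tB'].
    by rewrite derive1E; have [] := dF t; rewrite // tB.
have {}I : \int[mu]_(t in `[- B, B]) K t = 0.
  have FB : F B = 0 by rewrite /F g1B g2B !mul0r subrr.
  have FNB : F (- B) = 0 by rewrite /F g1NB g2NB !mul0r subrr.
  by rewrite /Rintegral I FB FNB subee.
have cN : cont (fun t => - g1' t) by exact: segment_contN.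
move: I; rewrite RintegralD//; try by apply: segment_cont_integrable;
  apply: segment_contZ; auto.
rewrite !RintegralZl//; try by auto.
by rewrite -/(trig_integral _ _ _) -/(trig_integral _ _ _) /k => ?; lra.
Qed.

End trig_integral.

(** * Real functions with smooth frequency densities supported inside []-B, B[] *)

Section band.
Context {R : realType}.
Notation mu := (@lebesgue_measure R).
Variable B : R.
Hypothesis B0 : 0 < B.
Implicit Types (g p h : R -> R) (x t : R).

Local Notation cont g := {within `[- B, B], continuous g}.
Local Notation T := (trig_integral B).

(** Strictness of [b < B] makes [g] and all its derivatives vanish near both endpoints, so repeated
    integration by parts never leaves a boundary term. *)
Definition flat g := smooth g /\
  exists2 b, 0 <= b < B & forall t, b <= `|t| -> g t = 0.

Lemma flat_smooth g : flat g -> smooth g. Proof. by case. Qed.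

Lemma flatM g p : flat g -> smooth p -> flat (fun t => p t * g t).
Proof.
move=> [sg [b bB g0]] sp; split; first exact: smoothM.
by exists b => // t /g0 ->; rewrite mulr0.
Qed.

Lemma flatZ c g : flat g -> flat (fun t => c * g t).
Proof. by move=> fg; apply: flatM => //; exact: smooth_cst. Qed.

Lemma flatN g : flat g -> flat (fun t => - g t).
Proof.
move=> [sg [b bB g0]]; split; first exact: smoothN.
by exists b => // t /g0 ->; rewrite oppr0.
Qed.

Lemma flatD g p : flat g -> flat p -> flat (fun t => g t + p t).
Proof.
move=> [sg [b /andP[b0 bB] g0]] [sp [d /andP[d0 dB] p0]]; split; first exact: smoothD.
exists (Num.max b d); first by rewrite le_max b0 /= gt_max bB.
by move=> t; rewrite ge_max => /andP[/g0 -> /p0 ->]; rewrite addr0.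
Qed.

Lemma flat_derive g : flat g ->
  exists2 g', flat g' & forall t, is_derive t 1 g (g' t).
Proof.
move=> [/smooth_derive[g' sg' dg] [b /andP[b0 bB] g0]].
(* The derivative is seen to vanish only where [g] vanishes on a neighbourhood, that is for
   [b < |t|]; the radius therefore moves from [b] to a point strictly between [b] and [B]. *)
exists g' => //; split => //; exists ((b + B) / 2); first by apply/andP; split; lra.
move=> t bt; have bt' : b < `|t| by lra.
have [_ <-] := dg t.
have -> : 'D_1 g t = 'D_1 (fun=> 0) t.
  apply: near_eq_derive; near=> s; apply: g0; apply/ltW.
  near: s; apply: cvgr_gt bt'; exact: norm_continuous.
by have [_ ->] := is_derive_cst (0 : R) t (1 : R).
Unshelve. all: by end_near. Qed.

Lemma flat_bnd g : flat g -> g B = 0 /\ g (- B) = 0.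
Proof.
move=> [_ [b /andP[b0 bB] g0]].
by split; apply: g0; rewrite ?normrN ger0_norm; lra.
Qed.

Lemma flat_cont g : flat g -> cont g.
Proof. by move=> /flat_smooth/smooth_continuous; exact: continuous_subspaceT. Qed.

Definition band h := exists g1 g2, [/\ flat g1, flat g2 & h = T g1 g2].

Lemma band_derive h : band h ->
  exists2 h', band h' & forall x, is_derive x 1 h (h' x).
Proof.
move=> [g1 [g2 [f1 f2 ->]]].
exists (T (fun t => 2 * pi * (t * g2 t)) (fun t => - (2 * pi * (t * g1 t)))).
  do 2 eexists; split; last reflexivity.
    by apply: flatZ; apply: flatM => //; exact: smooth_id.
  by apply: flatN; apply: flatZ; apply: flatM => //; exact: smooth_id.
by move=> x; apply: is_derive_trig_integral => //; exact: flat_cont.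
Qed.

Lemma band_mulX h : band h -> band (fun x => x * h x).
Proof.
move=> [g1 [g2 [f1 f2 ->]]].
have [g1' f1' d1] := flat_derive f1; have [g2' f2' d2] := flat_derive f2.
have [b1 b1'] := flat_bnd f1; have [b2 b2'] := flat_bnd f2.
have pi2 : 2 * pi != 0 :> R by rewrite mulf_neq0// lt0r_neq0// pi_gt0.
exists (fun t => (2 * pi)^-1 * g2' t), (fun t => (2 * pi)^-1 * - g1' t).
split; first exact: flatZ.
  by apply: flatZ; exact: flatN.
apply/funext => x; apply: (mulfI pi2).
rewrite (mul_trig_integral B0 x (flat_cont f1') (flat_cont f2'))//.
have := @trig_integral_lin R B (2 * pi) 0 (fun t => (2 * pi)^-1 * g2' t)
  (fun t => (2 * pi)^-1 * - g1' t) (fun=> 0) (fun=> 0) x.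
rewrite mul0r addr0 => ->.
- by apply: eq_trig_integral => t _; rewrite mulr0 addr0 mulrA divff// mul1r.
- by apply: flat_cont; exact: flatZ.
- by apply: flat_cont; apply: flatZ; exact: flatN.
- by apply: segment_contT => t; exact: cvg_cst.
- by apply: segment_contT => t; exact: cvg_cst.
Qed.

(** By integration by parts multiplication by [x] stays inside the class, so boundedness of every
    member already gives decay of every order. *)
Lemma band_decay h k : band h -> exists C, forall x, `|x ^+ k * h x| <= C.
Proof.
elim: k h => [|k IH] h bh; last first.
  have [C hC] := IH _ (band_mulX bh); exists C => x.
  by rewrite exprSr -mulrA.
move: bh => [g1 [g2 [f1 f2 ->]]].
have [C hC] := trig_integral_bounded (flat_cont f1) (flat_cont f2).
by exists C => x; rewrite mul1r.
Qed.

Lemma band_continuous h : band h -> continuous h.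
Proof. by move=> /band_derive[h' _ dh]; exact: is_derive_continuousT dh. Qed.

(** Translation by [s] rotates the pair of densities through the angle [2 * pi * s * t] and does not
    enlarge their supports. *)
Lemma band_shift h s : band h -> band (fun x => h (x - s)).
Proof.
move=> [g1 [g2 [f1 f2 ->]]].
pose c t := cos (2 * pi * s * t); pose d t := sin (2 * pi * s * t).
exists (fun t => c t * g1 t - d t * g2 t), (fun t => d t * g1 t + c t * g2 t).
split.
- apply: flatD; first by apply: flatM => //; exact: smooth_cos.
  by apply: flatN; apply: flatM => //; exact: smooth_sin.
- apply: flatD; first by apply: flatM => //; exact: smooth_sin.
  by apply: flatM => //; exact: smooth_cos.
- apply/funext => x; apply: eq_Rintegral => t _; rewrite /trig_kernel.
  rewrite (_ : 2 * pi * (x - s) * t = 2 * pi * x * t - 2 * pi * s * t); last by ring.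
  by rewrite cosB sinB -/(c t) -/(d t); ring.
Qed.

Lemma band_integrable h : band h -> mu.-integrable setT (EFin \o h).
Proof.
move=> bh; have [C0 h0] := band_decay 0 bh; have [C2 h2] := band_decay 2 bh.
apply: (@integrable_decay _ _ (C0 + C2)); first exact: band_continuous.
move=> x; rewrite mulrDr mulr1 lerD//; first by have := h0 x; rewrite mul1r.
by have := h2 x; rewrite mulrC normrM normrX real_normK ?num_real.
Qed.

Lemma integrable_trigM h c : band h ->
  mu.-integrable setT (fun x => (h x * cos (c * x))%:E) /\
  mu.-integrable setT (fun x => (h x * sin (c * x))%:E).
Proof.
move=> bh; have ih := band_integrable bh.
have ch := smooth_continuous (smooth_cos c).
have sh := smooth_continuous (smooth_sin c).
have bc := band_continuous bh.
split; apply: (le_integrable _ _ _ ih) => //.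
- apply/measurable_EFinP; apply: continuous_measurable_fun => x.
  by apply: continuousM; [exact: bc|exact: ch].
- by move=> x _; rewrite lee_fin normrM ler_piMr// ler_norml cos_geN1 cos_le1.
- apply/measurable_EFinP; apply: continuous_measurable_fun => x.
  by apply: continuousM; [exact: bc|exact: sh].
- by move=> x _; rewrite lee_fin normrM ler_piMr// ler_norml sin_geN1 sin_le1.
Qed.

(** A version of [flat] confined to the segment and to one derivative. It accommodates the factor
    [c / q] of [band_fourier0], whose poles lie beyond [[-B, B]]. *)
Definition c1_vanish p p' := [/\ cont p', forall t, - B <= t <= B -> is_derive t 1 p (p' t),
  p B = 0 & p (- B) = 0].

Lemma c1_vanish_cont p p' : c1_vanish p p' -> cont p.
Proof.
move=> [_ dp _ _]; apply: derivable_within_continuous => t; rewrite in_itv/= => tB.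
by have [] := dp _ tB.
Qed.

Lemma c1_vanishM p p' (r r' : R -> R) : c1_vanish p p' -> cont r' ->
  (forall t, - B <= t <= B -> is_derive t 1 r (r' t)) ->
  c1_vanish (fun t => r t * p t) (fun t => r t * p' t + p t * r' t).
Proof.
move=> cp cr dr; have pc := c1_vanish_cont cp; have [cp' dp pB pNB] := cp.
have rc : cont r.
  apply: derivable_within_continuous => t; rewrite in_itv/= => tB.
  by have [] := dr _ tB.
split; rewrite ?pB ?pNB ?mulr0//; first by apply: segment_contD; exact: segment_contM.
move=> t tB; have := dp t tB; have := dr t tB => d1 d2.
exact: is_deriveM.
Qed.

Lemma c1_vanishZ c p p' : c1_vanish p p' ->
  c1_vanish (fun t => c * p t) (fun t => c * p' t).
Proof.
move=> cp; have := @c1_vanishM p p' (fun=> c) (fun=> 0) cp.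
have -> : (fun t => c * p' t + p t * 0) = (fun t => c * p' t).
  by apply/funext => t; rewrite mulr0 addr0.
by apply; apply: segment_contT => t; exact: cvg_cst.
Qed.

Lemma c1_vanishX p p' : c1_vanish p p' ->
  c1_vanish (fun t => t * p t) (fun t => t * p' t + p t).
Proof.
move=> cp; have := @c1_vanishM p p' id (fun=> 1) cp.
have -> : (fun t => id t * p' t + p t * 1) = (fun t => t * p' t + p t).
  by apply/funext => t; rewrite mulr1.
by apply; apply: segment_contT => t; exact: cvg_cst.
Qed.

Lemma c1_vanish_decay p1 p1' p2 p2' : c1_vanish p1 p1' -> c1_vanish p2 p2' ->
  exists C, forall x, `|x * T p1 p2 x| <= C.
Proof.
move=> [c1 d1 b1 b1'] [c2 d2 b2 b2'].
have [C hC] := trig_integral_bounded c2 (segment_contN c1).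
have pi2 : 0 < 2 * pi :> R by rewrite mulr_gt0// pi_gt0.
exists ((2 * pi)^-1 * C) => x.
have := hC x; rewrite -(mul_trig_integral B0 x c1 c2)// normrM gtr0_norm// => H.
by rewrite ler_pdivlMl.
Qed.

(* If [h = T g1 g2], then [h2 = T p1 p2] with [p = c g / (c^2 - (2 pi t)^2)]
   solves [h2'' / c + c h2 = h], so that [h cos (c .)] and [h sin (c .)] have
   explicit primitives built from [h2] and [h2'], which vanish at infinity. *)
Lemma band_fourier0 h c : band h -> 2 * pi * B < `|c| ->
  (\int[mu]_x (h x * cos (c * x))%:E = 0)%E /\
  (\int[mu]_x (h x * sin (c * x))%:E = 0)%E.
Proof.
move=> bh Bc; have [i1 i2] := integrable_trigM c bh.
have bc := band_continuous bh.
have [g1 [g2 [f1 f2 hE]]] := bh.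
have c0 : c != 0.
  by rewrite -normr_gt0 (le_lt_trans _ Bc)// mulr_ge0 ?(ltW B0)// mulr_ge0// pi_ge0.
pose q t := c ^+ 2 - (2 * pi * t) ^+ 2.
have q0 t : - B <= t <= B -> q t != 0.
  rewrite -ler_norml => tB; rewrite lt0r_neq0// subr_gt0.
  rewrite -[ltRHS]real_normK ?num_real// -[ltLHS]real_normK ?num_real//.
  rewrite ltrXn2r// (le_lt_trans _ Bc)// normrM ger0_norm ?mulr_ge0 ?pi_ge0//.
  by rewrite ler_wpM2l// mulr_ge0// pi_ge0.
pose r t := c * (q t)^-1.
pose q' t := - (2 * (2 * pi) ^+ 2 * t).
have dq t : is_derive t 1 q (q' t).
  rewrite /q (_ : (fun t => _) = cst (c ^+ 2) - ((2 * pi) ^+ 2) *: (id ^+ 2 : R -> R)).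
    by apply: is_derive_eq; rewrite /GRing.scale/= /q'; ring.
  by apply/funext => s; rewrite exprMn.
pose r' t := - (c^-1 * (q' t * (r t * r t))).
have dr t : - B <= t <= B -> is_derive t 1 r (r' t).
  move=> tB; have dqt := dq t; have := is_deriveV (q0 _ tB) dqt => dV.
  rewrite /r (_ : (fun t => _) = c *: (fun t => (q t)^-1))//.
  apply: is_derive_eq; rewrite /GRing.scale/= /r' /r; field.
  by rewrite c0 q0.
have cr : cont r.
  apply: derivable_within_continuous => t; rewrite in_itv/= => tB.
  by have [] := dr _ tB.
have cr' : cont r'.
  apply: segment_contN; apply: segment_contZ; apply: segment_contM;
    last exact: segment_contM.
  by apply: segment_contN; apply: segment_contZ; exact: segment_cont_id.
have c1g g : flat g -> exists g', c1_vanish g g'.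
  move=> fg; have [g' fg' dg] := flat_derive fg; exists g'.
  by have [? ?] := flat_bnd fg; split => //; exact: flat_cont.
have [g1' cg1] := c1g _ f1; have [g2' cg2] := c1g _ f2.
have := c1_vanishM cg1 cr' dr; set p1 := (fun t => r t * g1 t);
  set p1' := (fun t => _) => cp1.
have := c1_vanishM cg2 cr' dr; set p2 := (fun t => r t * g2 t);
  set p2' := (fun t => _) => cp2.
have contp1 := c1_vanish_cont cp1; have contp2 := c1_vanish_cont cp2.
have cd1 := c1_vanishZ (2 * pi) (c1_vanishX cp2).
have cd2 := c1_vanishZ (- (2 * pi)) (c1_vanishX cp1).
pose h2 := T p1 p2.
pose h2' := T (fun t => 2 * pi * (t * p2 t)) (fun t => - (2 * pi) * (t * p1 t)).
have contd1 := c1_vanish_cont cd1; have contd2 := c1_vanish_cont cd2.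
pose h2'' := T (fun t => 2 * pi * (t * (- (2 * pi) * (t * p1 t))))
  (fun t => - (2 * pi * (t * (2 * pi * (t * p2 t))))).
have dh2 x : is_derive x 1 h2 (h2' x).
  have := is_derive_trig_integral B0 x contp1 contp2.
  congr is_derive; apply: eq_trig_integral => // t _; by rewrite mulNr.
have dh2' x : is_derive x 1 h2' (h2'' x) by exact: is_derive_trig_integral.
(* Two differentiations multiply the densities by [- (2 pi t)^2], so the left-hand side has
   densities [(q / c) * p], and [p = (c / q) * g]. *)
have ode x : c^-1 * h2'' x + c * h2 x = h x.
  rewrite hE trig_integral_lin//; last 2 first.
  - by apply: segment_contZ; apply: segment_contM => //; exact: segment_cont_id.
  - by apply: segment_contN; apply: segment_contZ; apply: segment_contM => //;
      exact: segment_cont_id.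
  apply: eq_trig_integral => t tB; rewrite /p1 /p2 /r.
  - by move: (q0 t tB); rewrite /q; generalize (@pi R) => P qt; field; rewrite c0 qt.
  - by move: (q0 t tB); rewrite /q; generalize (@pi R) => P qt; field; rewrite c0 qt.
have [C2 H2] := c1_vanish_decay cp1 cp2.
have [C2' H2'] := c1_vanish_decay cd1 cd2.
have dc x : is_derive x 1 (fun x => cos (c * x)) (- (c * sin (c * x))).
  have := is_derive_comp_affine (is_derive_cos (c * x + 0)).
  rewrite !addr0 mulNr mulrC; congr is_derive.
  by apply/funext => y; rewrite addr0.
have ds x : is_derive x 1 (fun x => sin (c * x)) (c * cos (c * x)).
  have := is_derive_comp_affine (is_derive_sin (c * x + 0)).
  rewrite !addr0 mulrC; congr is_derive.
  by apply/funext => y; rewrite addr0.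
have bnd (u v s w x : R) : `|u| <= 1 -> `|v| <= 1 -> `|x * s| <= C2 -> `|x * w| <= C2' ->
   `|x * (s * u + c^-1 * w * v)| <= C2 + `|c^-1| * C2'.
  move=> u1 v1 sC wC.
  rewrite (_ : x * _ = (x * s) * u + c^-1 * (x * w) * v); last by ring.
  rewrite (le_trans (ler_normD _ _))// lerD//.
    by rewrite normrM (le_trans _ sC)// ler_piMr.
  by rewrite normrM (@le_trans _ _ (`|c^-1 * (x * w)|)) ?ler_piMr// normrM ler_wpM2l.
have dQ (v w : R -> R) (v' w' x : R) : is_derive x 1 v v' -> is_derive x 1 w w' ->
    is_derive x 1 (h2 * v + (c^-1 *: h2') * w)
      (h2 x * v' + v x * h2' x + (c^-1 * h2' x * w' + w x * (c^-1 * h2'' x))).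
  move=> dv dw; have d1 := @is_deriveM _ _ _ _ _ _ _ _ (dh2 x) dv.
  have dz := @is_deriveZ _ _ _ _ c^-1 _ _ _ (dh2' x).
  have d2 := @is_deriveM _ _ _ _ _ _ _ _ dz dw.
  exact: (@is_deriveD _ _ _ _ _ _ _ _ _ d1 d2).
have cn1 x : `|cos (c * x)| <= 1 by rewrite ler_norml cos_geN1 cos_le1.
have sn1 x : `|sin (c * x)| <= 1 by rewrite ler_norml sin_geN1 sin_le1.
(* The two terms in [h2' * sin] cancel, and [ode] collapses the other two to [h * cos]; the sine
   case is the same up to signs. *)
have dC x : is_derive x 1 (h2 * (fun x => sin (c * x)) +
  (c^-1 *: h2') * (fun x => cos (c * x)))
    (h x * cos (c * x)).
  have := dQ _ _ _ _ _ (ds x) (dc x); congr is_derive.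
  by rewrite -ode; field; exact: c0.
have dS x : is_derive x 1 (h2 * (fun x => - cos (c * x)) +
  (c^-1 *: h2') * (fun x => sin (c * x)))
    (h x * sin (c * x)).
  have dcN : is_derive x 1 (fun x => - cos (c * x)) (- - (c * sin (c * x))).
    exact: (@is_deriveN _ _ _ _ _ _ _ (dc x)).
  have := dQ _ _ _ _ _ dcN (ds x); congr is_derive.
  by rewrite -ode; field; exact: c0.
have chc : continuous (fun x => h x * cos (c * x)).
  move=> x; apply: continuousM; first exact: bc.
  exact/smooth_continuous/smooth_cos.
have chs : continuous (fun x => h x * sin (c * x)).
  move=> x; apply: continuousM; first exact: bc.
  exact/smooth_continuous/smooth_sin.
split.
- apply: (integralT_primitive chc i1 dC (C := C2 + `|c^-1| * C2')) => x.
  exact: bnd.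
- apply: (integralT_primitive chs i2 dS (C := C2 + `|c^-1| * C2')) => x.
  by apply: bnd => //; rewrite normrN.
Qed.

Lemma band_sampling a : 0 < a -> 1 / (2 * a) < B -> exists h (C : R),
  [/\ band h, C != 0 & forall k : int, h (a * k%:~R) = if k == 0 then C else 0].
Proof.
move=> a0 aB; have [g [b [sg /andP[b0 bB] g0 [C C0 gC]]]] := sampling_freq a0 aB.
exists (T g (fun=> 0)), C; split => //.
- exists g, (fun=> 0); split => //.
    by split => //; exists b; rewrite ?(ltW b0).
  by split; [exact: smooth_cst|exists 0; rewrite ?lexx].
- move=> k; rewrite -gC; apply: eq_Rintegral => t _.
  by rewrite /trig_kernel mul0r addr0.
Qed.

End band.

(** * Tensor products and their Fourier transforms *)

Section tensor.
Context {R : realType}.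
Variable n : nat.
Implicit Types (h : 'I_n -> R -> R) (x : 'rV[R]_n).

Definition tensor h x : R := \prod_i h i (x 0 i).

Lemma differentiable_tensor h : (forall i (t : R), derivable (h i) t 1) ->
  forall x, differentiable (tensor h) x.
Proof.
move=> dh x; rewrite (_ : tensor h = fun x => \prod_(i <- index_enum 'I_n) h i (x 0 i))//.
elim: (index_enum _) => [|i s IH].
  rewrite (_ : (fun _ => _) = cst 1) //.
  by apply/funext => y; rewrite big_nil.
rewrite (_ : (fun _ => _) =
  (h i \o (fun y : 'rV[R]_n => y 0 i)) * (fun x => \prod_(i <- s) h i (x 0 i))).
  apply: differentiableM => //; apply: differentiable_comp.
    exact: differentiable_coord.
  exact/derivable1_diffP.
by apply/funext => y; rewrite big_cons.
Qed.

Lemma derive_tensor h (h' : R -> R) (i : 'I_n) :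
  (forall t : R, is_derive t 1 (h i) (h' t)) ->
  'D_(delta_mx 0 i) (tensor h) = tensor (fun j => if j == i then h' else h j).
Proof.
move=> dh; apply/funext => x.
pose C := \prod_(j | j != i) h j (x 0 j).
have tE s : tensor h (s *: delta_mx 0 i + x) = h i (s *: 1 + x 0 i) * C.
  rewrite /tensor (bigD1 i)//= !mxE !eqxx; congr (_ * _).
  by apply: eq_bigr => j ji; rewrite !mxE (negbTE ji) andbF mulr0 add0r.
have t0 : tensor h x = h i (x 0 i) * C by rewrite /tensor (bigD1 i).
have -> : tensor (fun j => if j == i then h' else h j) x = h' (x 0 i) * C.
  rewrite /tensor (bigD1 i)//= eqxx; congr (_ * _).
  by apply: eq_bigr => j /negbTE ->.
have [/cvg_ex[l hl] dE] := dh (x 0 i).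
have {}dE : h' (x 0 i) = l by rewrite -dE; exact: cvg_lim hl.
rewrite dE; apply: cvg_lim => //.
rewrite (_ : (fun _ => _) = (fun s => s^-1 *: ((h i \o shift (x 0 i)) (s *: 1) - h i (x 0 i)) * C)).
  by apply: cvgM => //; exact: cvg_cst.
apply/funext => s /=; rewrite tE t0 /GRing.scale/=; ring.
Qed.

Variable B : R.
Hypothesis B0 : 0 < B.

(** Differentiating a tensor product changes one factor and keeps it in the class, so the Schwartz
    bounds reduce to products of one-variable bounds. *)
Lemma partials_tensor h (s : seq 'I_n) : (forall i, band B (h i)) ->
  exists2 h', (forall i, band B (h' i)) & partials s (tensor h) = tensor h'.
Proof.
move=> bh; elim: s => [|i s [h1 bh1 E]]; first by exists h.
have [d bd dd] := band_derive B0 (bh1 i).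
exists (fun j => if j == i then d else h1 j).
  by move=> j; case: ifP.
by rewrite /partials /= -/(partials s (tensor h)) E (derive_tensor dd).
Qed.

Lemma schwartz_tensor h : (forall i, band B (h i)) -> schwartz_real (tensor h).
Proof.
move=> bh; split.
  move=> s x; have [h' bh' ->] := partials_tensor s bh.
  apply: differentiable_tensor => i t.
  by have [d _ dd] := band_derive B0 (bh' i); have [] := dd t.
move=> s k; have [h' bh' ->] := partials_tensor s bh.
have [C hC] := choice (fun i => band_decay B0 (k i) (bh' i)).
exists (\prod_i C i) => x; rewrite /tensor -big_split/= normr_prod.
by apply: ler_prod => i _; rewrite normr_ge0 hC.
Qed.

End tensor.

Lemma product_sigma_finite d1 d2 (T1 : measurableType d1) (T2 : measurableType d2)
    (R : realType) (m1 : {sigma_finite_measure set T1 -> \bar R})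
    (m2 : {sigma_finite_measure set T2 -> \bar R}) :
  sigma_finite setT (m1 \x m2)%E.
Proof.
have /sigma_finiteP[F [FT ndF Foo]] := sigma_finiteT m1.
have /sigma_finiteP[G [GT ndG Goo]] := sigma_finiteT m2.
exists (fun n => F n `*` G n) => [|n].
  apply/seteqP; split => // -[x y] _.
  have [i _ Fx] : (\bigcup_n F n) x by rewrite -FT.
  have [j _ Gy] : (\bigcup_n G n) y by rewrite -GT.
  exists (maxn i j) => //; split => /=.
    exact: (subsetPset _ _ (ndF _ _ (leq_maxl i j))).
  exact: (subsetPset _ _ (ndG _ _ (leq_maxr i j))).
have [mF Fn] := Foo n; have [mG Gn] := Goo n; split; first exact: measurableX.
by rewrite product_measure1E// lte_mul_pinfty// ge0_fin_numE.
Qed.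

(** * Borel sets and Lebesgue measure on [R^n] *)

Section borel_rV.
Context {R : realType}.

Lemma open_measurable_rV n (U : set 'rV[R]_n) : open U ->
  measurable (U : set (borel_rV R n)).
Proof. by move=> oU; apply: sub_sigma_algebra. Qed.

Lemma measurable_rVE n : @measurable _ (borel_rV R n) = <<s @open 'rV[R]_n >>.
Proof. by []. Qed.

Lemma continuous_measurable_rV n (f : 'rV[R]_n -> R) : continuous f ->
  measurable_fun setT (f : borel_rV R n -> R).
Proof.
move=> /continuousP cf; apply: (measurability _ (RGenOpens.measurableE R)).
move=> _ [_ [x [y ->]] <-]; rewrite setTI.
by apply: open_measurable_rV; apply: cf; exact: interval_open.
Qed.

Lemma measurable_coord n (i : 'I_n) :
  measurable_fun setT (fun x : borel_rV R n => (x : 'rV[R]_n) 0 i).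
Proof. by apply: continuous_measurable_rV => x; exact: coord_continuous. Qed.

(** Second countability: an open set is the union of the rational cubes [c p] that it contains.
    These are countably many, and the preimage of each is a finite intersection of conditions on
    single coordinates. *)
Lemma measurable_fun_rV d (T : measurableType d) n (f : T -> 'rV[R]_n) :
  (forall i, measurable_fun setT (fun w => f w 0 i)) ->
  measurable_fun setT (f : T -> borel_rV R n).
Proof.
move=> mf; apply: (measurability _ (measurable_rVE n)).
move=> _ [U oU <-]; rewrite setTI.
pose c (p : 'rV[rat]_n * nat) : set 'rV[R]_n :=
  [set x | forall i, `|ratr (p.1 0 i) - x 0 i| < p.2.+1%:R^-1].
have mc p : measurable (f @^-1` c p).
  rewrite (_ : _ @^-1` _ = \bigcap_(i in [set: 'I_n])
      [set w | `|ratr (p.1 0 i) - f w 0 i| < p.2.+1%:R^-1]); last first.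
    by apply/seteqP; split => w /= cw i; [move=> _; exact: cw|exact: (cw i I)].
  apply: fin_bigcap_measurable; first exact: finite_finset.
  move=> i _; rewrite -[X in measurable X]setTI.
  have := @measurable_funB _ _ _ setT (cst (ratr (p.1 0 i))) (fun w => f w 0 i).
  move=> /(_ (@measurable_cst _ _ _ _ setT _) (mf i)) => mfi.
  have := measurableT_comp (@normr_measurable R setT) mfi.
  move=> /(_ measurableT [set` `]-oo, p.2.+1%:R^-1[] (measurable_itv _)).
  by congr measurable; apply/seteqP; split => w /=; rewrite in_itv.
have -> : f @^-1` U = \bigcup_(k in setT)
    (if unpickle k is Some p then if `[< c p `<=` U >] then f @^-1` c p else set0 else set0).
  apply/seteqP; split => w /=; last first.
    by move=> [k _]; case: unpickle => // p; case: ifPn => // /asboolP; exact.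
  move=> Ufw; have := oU; rewrite openE => /(_ _ Ufw) /nbhs_ballP[e /= e0 eU].
  (* A cube of radius below [e / 2] that contains [f w] stays within distance [e] of it, hence
     inside [U]. *)
  have [k] : exists k, 0 + k.+1%:R^-1 < e / 2 by apply: ltr_add_invr; rewrite divr_gt0.
  rewrite add0r => ke; have k0 : 0 < k.+1%:R^-1 :> R by rewrite invr_gt0.
  have /choice[q hq] : forall i, exists q : rat, `|ratr q - f w 0 i| < k.+1%:R^-1.
    move=> i; have : f w 0 i - k.+1%:R^-1 < f w 0 i +
      k.+1%:R^-1 by rewrite ltrBlDr -addrA ltrDl addr_gt0.
    move=> /rat_in_itvoo[q]; rewrite in_itv/= => /andP[q1 q2]; exists q.
    by rewrite ltr_distl q1.
  pose p : 'rV[rat]_n * nat := (\row_i q i, k).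
  exists (pickle p) => //; rewrite pickleK ifT; first by move=> i; rewrite /= mxE.
  apply/asboolP => x cx; apply: eU; split => // i j; rewrite ord1 {i}.
  have := cx j; rewrite /= mxE => xj; have := hq j.
  move=> fj; rewrite /ball/= [ltRHS]splitr;
    apply: le_lt_trans (ler_distD (ratr (q j)) _ _) _.
  by apply: ltrD; rewrite (lt_trans _ ke)// distrC.
apply: bigcupT_measurable => k; case: unpickle => // p.
by case: ifP.
Qed.

Lemma cons_rV0 n (p : R * borel_rV R n) : (cons_rV p : 'rV[R]_n.+1) 0 ord0 = p.1.
Proof.
have -> : ord0 = lshift n (@ord0 0) :> 'I_(1 + n) by exact: val_inj.
by rewrite [LHS]row_mxEl mxE eqxx mulr1n.
Qed.

Lemma cons_rVS n (p : R * borel_rV R n) i :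
  (cons_rV p : 'rV[R]_n.+1) 0 (lift ord0 i) = (p.2 : 'rV[R]_n) 0 i.
Proof.
have -> : lift ord0 i = rshift 1 i :> 'I_(1 + n) by exact: val_inj.
by rewrite [LHS]row_mxEr.
Qed.

Lemma measurable_cons_rV n :
  measurable_fun [set: measurableTypeR R * borel_rV R n] (@cons_rV R n).
Proof.
apply: measurable_fun_rV => i; case: (unliftP ord0 i) => [j ->|->].
  under eq_fun do rewrite cons_rVS.
  exact: (measurableT_comp (measurable_coord j) measurable_snd).
under eq_fun do rewrite cons_rV0.
exact: measurable_fst.
Qed.

Definition uncons_rV n (x : borel_rV R n.+1) : R * borel_rV R n :=
  ((x : 'rV[R]_n.+1) 0 ord0, (\row_i (x : 'rV[R]_n.+1) 0 (lift ord0 i)) : 'rV[R]_n).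

Lemma cons_rVK n : cancel (@cons_rV R n) (@uncons_rV n).
Proof.
move=> p; rewrite /uncons_rV cons_rV0 [RHS]surjective_pairing; congr (_, _).
by apply/rowP => i; rewrite mxE cons_rVS.
Qed.

Lemma measurable_uncons_rV n :
  measurable_fun setT (@uncons_rV n : _ -> measurableTypeR R * borel_rV R n).
Proof.
apply: measurable_fun_pair; first exact: measurable_coord.
apply: measurable_fun_rV => i.
under eq_fun do rewrite mxE.
exact: measurable_coord.
Qed.

(** The recursion defines a bare set function. Fubini at the next dimension takes a sigma-finite
    measure, and an exhaustion of the product is carried over to row vectors by [uncons_rV]. *)
Lemma lebesgue_rV_sigma_finite n :
  exists m : {sigma_finite_measure set (borel_rV R n) -> \bar R},
    (m : set _ -> \bar R) = @lebesgue_rV R n.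
Proof.
elim: n => [|n [m mE]].
  by exists (dirac ((0 : 'rV[R]_0) : borel_rV R 0)).
have mc := @measurable_cons_rV n.
have mufin := product_sigma_finite (@lebesgue_measure R) m.
pose mu := [the {measure set _ -> \bar R} of (@lebesgue_measure R \x m)%E].
pose nu_ := [the {measure set (borel_rV R n.+1) -> \bar R} of pushforward mu (@cons_rV R n)].
pose nu := nu_ mc.
have nu_fin : sigma_finite setT nu.
  have [F FT Foo] := mufin.
  exists (fun i => @uncons_rV n @^-1` F i).
    by rewrite -preimage_bigcup -FT preimage_setT.
  move=> i; have [mF Fi] := Foo i; split.
    by rewrite -[X in measurable X]setTI; exact: measurable_uncons_rV.
  rewrite /nu /= /pushforward.
  by rewrite (_ : _ @^-1` _ = F i)//; apply/seteqP; split => p /=; rewrite cons_rVK.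
pose H := @Measure_isSigmaFinite.Build _ _ _ (Measure.sort nu) nu_fin.
pose nu' := HB.pack_for (SigmaFiniteMeasure.type (borel_rV R n.+1) R) (Measure.sort nu) H.
by exists nu'; rewrite /= /nu /mu /= mE.
Qed.

End borel_rV.

Section product_integral.
Local Open Scope ereal_scope.
Context d1 d2 (T1 : measurableType d1) (T2 : measurableType d2) (R : realType).
Context (m1 : {sigma_finite_measure set T1 -> \bar R})
        (m2 : {sigma_finite_measure set T2 -> \bar R}).

Lemma integrable_prodM (f1 : T1 -> R) (f2 : T2 -> R) :
  m1.-integrable setT (EFin \o f1) -> m2.-integrable setT (EFin \o f2) ->
  (m1 \x m2).-integrable setT (fun p => (f1 p.1 * f2 p.2)%:E) /\
  \int[m1 \x m2]_p (f1 p.1 * f2 p.2)%:E = \int[m1]_x (f1 x)%:E * \int[m2]_y (f2 y)%:E.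
Proof.
move=> i1 i2; have /integrableP[/measurable_EFinP mf1 l1] := i1.
have /integrableP[/measurable_EFinP mf2 l2] := i2.
have mf : measurable_fun setT (fun p : T1 * T2 => (f1 p.1 * f2 p.2)%:E).
  apply/measurable_EFinP; apply: measurable_funM.
  - exact: (measurableT_comp mf1 measurable_fst).
  - exact: (measurableT_comp mf2 measurable_snd).
have i12 : (m1 \x m2).-integrable setT (fun p => (f1 p.1 * f2 p.2)%:E).
  apply/integrable12ltyP => //=.
  under eq_integral => x _.
    under eq_integral do rewrite normrM EFinM.
    rewrite ge0_integralZl//; last first.
      by apply/measurable_EFinP; exact: measurableT_comp.
    over.
  rewrite ge0_integralZr//.
  - by rewrite lte_mul_pinfty// ?integral_ge0// ge0_fin_numE// integral_ge0.
  - by apply/measurable_EFinP; exact: measurableT_comp.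
  - exact: integral_ge0.
split => //; rewrite -integral12_prod_meas1//=.
under eq_integral => x _.
  rewrite /fubini_F/=; under eq_integral do rewrite EFinM.
  rewrite integralZl//; over.
have f2fin : \int[m2]_y (f2 y)%:E \is a fin_num by exact: integrable_fin_num.
by rewrite -(fineK f2fin) integralZr.
Qed.

End product_integral.

(** * Fourier transforms of tensor products *)

Section fourier_tensor.
Context {R : realType}.
Variable B : R.
Hypothesis B0 : 0 < B.

Definition phase n (xi x : 'rV[R]_n) : R := - (2 * pi * \sum_i x 0 i * xi 0 i).

Lemma measurable_phase n (xi : 'rV[R]_n) :
  measurable_fun setT (fun x : borel_rV R n => phase xi x).
Proof.
apply/measurable_funN.
apply: measurable_funM => //; apply: measurable_sum => i.
by apply: measurable_funM => //; exact: measurable_coord.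
Qed.

Lemma measurable_tensor n (h : 'I_n -> R -> R) : (forall i, band B (h i)) ->
  measurable_fun setT (fun x : borel_rV R n => tensor h x).
Proof.
move=> bh; apply: continuous_measurable_rV => x; apply: differentiable_continuous.
apply: differentiable_tensor => i t.
by have [d _ dd] := band_derive B0 (bh i); have [] := dd t.
Qed.

Lemma tensor_cons_rV n (h : 'I_n.+1 -> R -> R) (p : R * borel_rV R n) :
  tensor h (cons_rV p : 'rV[R]_n.+1) =
  h ord0 p.1 * tensor (fun i => h (lift ord0 i)) (p.2 : 'rV[R]_n).
Proof.
rewrite /tensor big_ord_recl cons_rV0; congr (_ * _).
by apply: eq_bigr => i _; rewrite cons_rVS.
Qed.

Lemma phase_cons_rV n (xi : 'rV[R]_n.+1) (p : R * borel_rV R n) :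
  phase xi (cons_rV p) =
  - (2 * pi * xi 0 ord0) * p.1 + phase (\row_i xi 0 (lift ord0 i)) (p.2 : 'rV[R]_n).
Proof.
rewrite /phase big_ord_recl cons_rV0.
under eq_bigr do rewrite cons_rVS.
under [in RHS]eq_bigr do rewrite mxE.
by ring.
Qed.

(** Induction on the dimension. The addition formulas split the integrand into products of a
    function of the first coordinate and one of the others. If the first frequency exceeds [B],
    [band_fourier0] kills the first factor of every term; otherwise the induction hypothesis kills
    the second. Integrability is proved alongside because Fubini in the next dimension consumes
    it. *)
Lemma fourier_tensor_integrals n (m : {sigma_finite_measure set (borel_rV R n) -> \bar R})
    (h : 'I_n -> R -> R) (xi : 'rV[R]_n) :
  (m : set _ -> \bar R) = @lebesgue_rV R n -> (forall i, band B (h i)) ->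
  [/\ m.-integrable setT (fun x => (tensor h x * cos (phase xi x))%:E),
      m.-integrable setT (fun x => (tensor h x * sin (phase xi x))%:E) &
      (exists i, B < `|xi 0 i|) ->
      (\int[m]_x (tensor h x * cos (phase xi x))%:E = 0)%E /\
      (\int[m]_x (tensor h x * sin (phase xi x))%:E = 0)%E].
Proof.
elim: n m h xi => [|n IH] m h xi mE bh.
  have I (f : borel_rV R 0 -> R) : m.-integrable setT (fun x => (f x)%:E).
    have -> : f = cst (f 0).
      by apply/funext => x; rewrite (thinmx0 (x : 'rV[R]_0)).
    apply/integrableP; split => //=; have := integral_cst m measurableT `|f 0|%:E.
    rewrite (_ : (\int[m]_x _ = \int[m]_x (cst `|f 0|%:E x))%E)// => ->.
    have mT : ((m : set _ -> \bar R) setT = 1)%E by rewrite mE /= diracT.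
    by rewrite [X in (_ * X)%E]mT mule1 ltry.
  by split => // -[[]].
have [m' mE'] := @lebesgue_rV_sigma_finite R n.
pose h' i := h (lift ord0 i); pose xi' := \row_i xi 0 (lift ord0 i).
have [iC iS Z] := IH m' h' xi' mE' (fun i => bh _).
pose c := - (2 * pi * xi 0 ord0).
have [jC jS] := integrable_trigM B0 c (bh ord0).
have [CC CCE] := integrable_prodM jC iC; have [SS SSE] := integrable_prodM jS iS.
have [CS CSE] := integrable_prodM jC iS; have [SC SCE] := integrable_prodM jS iC.
pose C (x : borel_rV R n.+1) := (tensor h x * cos (phase xi x))%:E.
pose S (x : borel_rV R n.+1) := (tensor h x * sin (phase xi x))%:E.
have CE p : C (cons_rV p) =
  ((h ord0 p.1 * cos (c * p.1) * (tensor h' p.2 * cos (phase xi' p.2)))%:E -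
   (h ord0 p.1 * sin (c * p.1) * (tensor h' p.2 * sin (phase xi' p.2)))%:E)%E.
  by rewrite /C tensor_cons_rV phase_cons_rV cosD -EFinB; congr EFin;
    rewrite /h' /c /xi'; ring.
have SE p : S (cons_rV p) =
  ((h ord0 p.1 * sin (c * p.1) * (tensor h' p.2 * cos (phase xi' p.2)))%:E +
   (h ord0 p.1 * cos (c * p.1) * (tensor h' p.2 * sin (phase xi' p.2)))%:E)%E.
  by rewrite /S tensor_cons_rV phase_cons_rV sinD -EFinD; congr EFin;
    rewrite /h' /c /xi'; ring.
have mc := @measurable_cons_rV R n.
have mC : measurable_fun setT C.
  apply/measurable_EFinP; apply: measurable_funM; first exact: measurable_tensor.
  have mcos : measurable_fun setT (@cos R) by apply: continuous_measurable_fun;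
    exact: continuous_cos.
  exact: (measurableT_comp mcos (measurable_phase xi)).
have mS : measurable_fun setT S.
  apply/measurable_EFinP; apply: measurable_funM; first exact: measurable_tensor.
  have msin : measurable_fun setT (@sin R) by apply: continuous_measurable_fun;
    exact: continuous_sin.
  exact: (measurableT_comp msin (measurable_phase xi)).
have intC : (lebesgue_measure \x m')%E.-integrable setT (C \o @cons_rV R n).
  rewrite (_ : _ \o _ = fun p => C (cons_rV p))//.
  rewrite (funext CE); exact: integrableB.
have intS : (lebesgue_measure \x m')%E.-integrable setT (S \o @cons_rV R n).
  rewrite (_ : _ \o _ = fun p => S (cons_rV p))//.
  rewrite (funext SE); exact: integrableD.
have push f : measurable_fun setT f ->
   (lebesgue_measure \x m')%E.-integrable setT (f \o @cons_rV R n) ->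
   m.-integrable setT f /\ (\int[m]_x f x = \int[lebesgue_measure \x m']_p f (cons_rV p))%E.
  move=> mf intf; split.
    apply/integrableP; split => //; rewrite mE /= -mE' ge0_integral_pushforward//.
      by have /integrableP[] := intf.
    exact: measurableT_comp.
  by rewrite mE /= -mE' integral_pushforward.
have [mintC EC] := push _ mC intC; have [mintS ES] := push _ mS intS.
split => // -[i xiB].
rewrite EC ES; under eq_integral do rewrite CE.
under [in X in _ /\ X]eq_integral do rewrite SE.
rewrite integralB// integralD// CCE SSE CSE SCE.
case: (unliftP ord0 i) xiB => [j ->|->] xiB.
  have [|-> ->] := Z; first by exists j; rewrite mxE.
  by rewrite !mule0 adde0 sube0.
have [|-> ->] := @band_fourier0 _ _ B0 _ c (bh ord0); last by rewrite !mul0e adde0 sube0.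
rewrite /c normrN normrM ger0_norm ?mulr_ge0 ?pi_ge0//.
by rewrite ltr_pM2l// mulr_gt0// pi_gt0.
Qed.

End fourier_tensor.

Section test_function.
Context {R : realType}.

Lemma schwartz_real0 n : schwartz_real (fun _ : 'rV[R]_n => 0 : R).
Proof.
have P0 s : partials s (fun _ : 'rV[R]_n => 0 : R) = fun=> 0.
  elim: s => [//|i s IH]; rewrite /partials /= -/(partials _ _) IH.
  by apply/funext => x; exact: derive_cst.
split; first by move=> s x; rewrite P0; exact: differentiable_cst.
by move=> s k; exists 0 => x; rewrite P0 mulr0 normr0.
Qed.

Lemma closed_box n (B : R) : closed [set x : 'rV[R]_n | forall i, - B <= x 0 i <= B].
Proof.
rewrite (_ : mkset _ = \bigcap_(i in [set: 'I_n])
    ((fun x : 'rV[R]_n => x 0 i) @^-1` [set` `[- B, B]])); last first.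
  apply/seteqP; split => x /= Hx i; first by move=> _; rewrite /= in_itv/=; exact: Hx.
  by have := Hx i I; rewrite /= in_itv.
apply: closed_bigI => i _; apply: preimage_closed.
  by move=> x _; exact: coord_continuous.
exact: interval_closed.
Qed.

Lemma fourier_tensor_support n (B : R) (h : 'I_n -> R -> R) : 0 < B ->
  (forall i, band B (h i)) ->
  closed_support (fourier (fun x => (tensor h x)%:C%C)) `<=`
    [set xi | forall i, - B <= xi 0 i <= B].
Proof.
move=> B0 bh; rewrite [X in _ `<=` X](closure_id _).1; last exact: closed_box.
apply: closureS => xi /=; apply: contra_neqP => /existsNP[j].
rewrite -ler_norml => /negP; rewrite -ltNge => Bj.
have [m mE] := @lebesgue_rV_sigma_finite R n.
have [_ _ /(_ (ex_intro _ j Bj))[ZC ZS]] := fourier_tensor_integrals B0 xi mE bh.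
rewrite /fourier -mE.
under eq_integral do rewrite /= mul0r subr0.
under [X in (_ +i* fine X)%C]eq_integral do rewrite /= mul0r addr0.
by rewrite ZC ZS.
Qed.

Lemma lattice_test_function (a B : R) n : 0 < a -> 1 / (2 * a) < B ->
  exists2 C : R, C != 0 & forall k : 'I_n -> int, exists eta : 'rV[R]_n -> R,
    [/\ schwartz (fun x => (eta x)%:C%C),
        closed_support (fourier (fun x => (eta x)%:C%C)) `<=`
          [set xi | forall i, - B <= xi 0 i <= B] &
        forall j : 'I_n -> int, eta (\row_i (a * (j i)%:~R)) =
          if [forall i, j i == k i] then C else 0].
Proof.
move=> a0 aB; have B0 : 0 < B.
  by rewrite (le_lt_trans _ aB)// divr_ge0// mulr_ge0// ltW.
have [h [C [bh C0 hC]]] := band_sampling B0 a0 aB.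
exists (C ^+ n); first by rewrite expf_neq0.
move=> k; pose g i x := h (x - a * (k i)%:~R).
have bg i : band B (g i) by exact: band_shift.
exists (tensor g); split.
- by split; [exact: schwartz_tensor bg|exact: schwartz_real0].
- exact: fourier_tensor_support.
- move=> j; rewrite /tensor /g; case: ifPn => [/forallP jk|].
    rewrite (eq_bigr (fun=> C)) ?prodr_const ?card_ord//.
    by move=> i _; rewrite mxE (eqP (jk i)) -mulrBr -rmorphB/= hC subrr eqxx.
  rewrite negb_forall => /existsP[i jk]; rewrite (bigD1 i)//= mxE -mulrBr -rmorphB/= hC.
  by rewrite subr_eq0 (negbTE jk) mul0r.
Qed.

End test_function.

(** * Mean counts of tuples at lattice sites *)

Section integral_modulo_null.
Local Open Scope ereal_scope.
Context d (T : measurableType d) (R : realType) (mu : {measure set T -> \bar R}).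
Implicit Types (f g : T -> \bar R) (N : set T).
Import HBNNSimple.

(* The integral of a non-measurable function is a difference of lower
   integrals, so it still ignores null sets. *)
Lemma ge0_le_integral_null f g N : measurable N -> mu N = 0 ->
  (forall x, 0 <= f x) -> (forall x, 0 <= g x) -> (forall x, ~ N x -> f x <= g x) ->
  \int[mu]_x f x <= \int[mu]_x g x.
Proof.
move=> mN N0 f0 g0 fg; rewrite !ge0_integralTE//; apply: ge_ereal_sup => _ [h hf <-].
(* Cutting the simple function off on [N] leaves its integral unchanged and puts it below [g] at
   every point. *)
pose h' := proj_nnsfun h (measurableC mN).
have h'E x : h' x = (h x * \1_(~` N) x)%R by [].
have -> : sintegral mu h = sintegral mu h'.
  rewrite -!integralT_nnsfun; apply: ge0_ae_eq_integral => //.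
  - exact/measurable_EFinP.
  - exact/measurable_EFinP.
  - by move=> x _; rewrite lee_fin.
  - by move=> x _; rewrite lee_fin.
  - exists N; split => // x /=; apply: contra_notP => Nx _.
    congr EFin; apply/esym; apply: (etrans (h'E x)).
    by rewrite indicE mem_set// mulr1.
apply: ereal_sup_ubound; exists h' => // x; rewrite h'E indicE.
have [Nx|Nx] := pselect (N x).
  by rewrite memNset ?mulr0//= => /(_ Nx).
by rewrite mem_set// mulr1 (le_trans (hf x))// fg.
Qed.

Lemma eq_integral_null f g N : measurable N -> mu N = 0 ->
  (forall x, ~ N x -> f x = g x) -> \int[mu]_x f x = \int[mu]_x g x.
Proof.
move=> mN N0 fg; rewrite integralE [RHS]integralE.
by congr (_ - _); apply/eqP; rewrite eq_le; apply/andP; split;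
  apply: (ge0_le_integral_null mN N0) => // x Nx; rewrite ?funeposE ?funenegE fg.
Qed.

End integral_modulo_null.

(** * Counting tuples of distinct labels through occupation numbers *)

Section tuple_count.
Context {R : realType}.
Variable n : nat.
Implicit Types (k : {ffun 'I_n -> int}) (m : {ffun 'I_n -> nat}).

(* A label located at [a * k i] is replaced by its rank among the labels at that
   site, so that counting tuples of distinct labels only involves the site
   occupation numbers [m], which are measurable. *)
Definition rank_tuples k m : set {ffun 'I_n -> nat} :=
  [set r : {ffun 'I_n -> nat} | (forall i, (r i < m i)%N) /\
     injective (fun i => (k i, r i))].

(** When [m i] depends on [k i] alone, this is a product of falling factorials, one for each
    distinct site among the [k i]. *)
Definition tuple_count k m : \bar R := \esum_(r in rank_tuples k m) 1%:E.

Lemma tuple_count_ge0 k m : (0 <= tuple_count k m)%E.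
Proof. by apply: esum_ge0. Qed.

Definition ffun_val M (t : {ffun 'I_n -> 'I_M}) : {ffun 'I_n -> nat} :=
  [ffun i => val (t i)].

Lemma rank_tuples_sub k m M : (forall i, (m i <= M)%N) ->
  rank_tuples k m `<=` @ffun_val M @` setT.
Proof.
move=> mM r [rm _]; have rM i : (r i < M)%N := leq_trans (rm i) (mM i).
exists [ffun i => Ordinal (rM i)] => //.
by apply/ffunP => i; rewrite !ffunE.
Qed.

Lemma finite_rank_tuples k m : finite_set (rank_tuples k m).
Proof.
apply: sub_finite_set (@rank_tuples_sub k m (\max_i m i) _) _.
  by move=> i; exact: leq_bigmax.
by apply: finite_image; exact: finite_finset.
Qed.

Lemma esum_rank_tuples k m (x : \bar R) : (0 <= x)%E ->
  (\esum_(r in rank_tuples k m) x = x * tuple_count k m)%E.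
Proof.
move=> x0; rewrite /tuple_count !esum_fset//; try exact: finite_rank_tuples.
rewrite ge0_mule_fsumr//.
by apply: eq_fsbigr => r _; rewrite mule1.
Qed.

(** There are at most [M ^ n] tuples, [M] being the largest occupation number, and [M ^ n] is one of
    the summands. A sum of n-th powers is what the moment bounds of [ulm] control. *)
Lemma tuple_count_le k m : (0 < n)%N -> (tuple_count k m <= (\sum_i (m i)%:R ^+ n)%:E)%E.
Proof.
move=> n0; pose M := (\max_i m i)%N.
have mM i : (m i <= M)%N by exact: leq_bigmax.
have inj : set_inj setT (@ffun_val M).
  move=> s t _ _ /ffunP st; apply/ffunP => i; apply: val_inj.
  by have := st i; rewrite !ffunE.
apply: (@le_trans _ _ (\esum_(r in @ffun_val M @` setT) 1%:E)%E).
  rewrite /tuple_count esum_mkcond [leRHS]esum_mkcond; apply: le_esum => r _.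
  case: ifPn; case: ifPn => //; rewrite notin_setE => nr /set_mem rk.
  by case: nr; exact: rank_tuples_sub rk.
rewrite esum_image// esum_fset//; last exact: finite_finset.
have -> : [set: {ffun 'I_n -> 'I_M}] = [set` index_enum {ffun 'I_n -> 'I_M}].
  by apply/seteqP; split => t //= _; exact: mem_index_enum.
rewrite -fsbig_seq ?index_enum_uniq//= sumEFin lee_fin sumr_const card_ffun !card_ord.
have [i0 Mi0] : exists i0, M = m i0.
  by have [|i0 ?] := @bigop.eq_bigmax _ m; [rewrite card_ord|exists i0].
rewrite natrX Mi0 (bigD1 i0)//= lerDl sumr_ge0//.
Qed.

End tuple_count.

Section label_tuples.
Context {R : realType}.
Variables (n : nat) (a : R).
Hypothesis a0 : 0 < a.
Implicit Types (c : configuration R) (k : {ffun 'I_n -> int}).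

Definition site k : 'rV[R]_n := \row_i (a * (k i)%:~R).

Definition site_counts k c : {ffun 'I_n -> nat} :=
  [ffun i => npoints [set a * (k i)%:~R] c].

Definition label_tuples k c : set {ffun 'I_n -> nat} :=
  [set j : {ffun 'I_n -> nat} | distinct_labels c n j /\
     forall i, points c (j i) = a * (k i)%:~R].

Lemma labels_at c (x : R) : exists L : seq nat,
  [/\ uniq L, size L = npoints [set x] c &
      forall l, l \in L <-> labels c l /\ points c l = x].
Proof.
have fin : finite_set (labels c `&` points c @^-1` [set x]).
  apply: locally_finite; exists `|x|; split; first exact: num_real.
  by move=> M xM y /= ->; exact: ltW.
exists (finmap.enum_fset (fset_set (labels c `&` points c @^-1` [set x]))); split => //.
  exact: finmap.fset_uniq.
by move=> l; rewrite -[_ \in _]/(l \in fset_set _) in_fset_set// inE.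
Qed.

(** Labels at a site are listed once, whatever the index [i], so equal sites share a list and
    distinct labels there have distinct ranks. Equal labels have equal positions, hence equal [k i]
    since [a] is nonzero. *)
Lemma label_tuples_bij k c : exists e : {ffun 'I_n -> nat} -> {ffun 'I_n -> nat},
  set_bij (rank_tuples k (site_counts k c)) (label_tuples k c) e.
Proof.
have /choice[L HL] := labels_at c.
pose l (i : 'I_n) := L (a * (k i)%:~R).
have lu i : uniq (l i) by have [] := HL (a * (k i)%:~R).
have ls i : size (l i) = site_counts k c i.
  by rewrite ffunE; have [] := HL (a * (k i)%:~R).
have lin i x : x \in l i <-> labels c x /\ points c x = a * (k i)%:~R.
  by have [_ _] := HL (a * (k i)%:~R); exact.
exists (fun r : {ffun 'I_n -> nat} => [ffun i => nth 0%N (l i) (r i)]); split.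
- move=> r [rm rinj].
  have mem i : nth 0%N (l i) (r i) \in l i by rewrite mem_nth// ls.
  split; last by move=> i; rewrite ffunE; have [] := (lin _ _).1 (mem i).
  split; last by move=> i; rewrite ffunE; have [] := (lin _ _).1 (mem i).
  move=> i i'; rewrite !ffunE => E.
  have kk : k i = k i'.
    have [_ p1] := (lin _ _).1 (mem i); have [_ p2] := (lin _ _).1 (mem i').
    move: p1; rewrite E p2 => /(mulfI (lt0r_neq0 a0)) /eqP.
    by rewrite eqr_int => /eqP.
  apply: rinj; congr (_, _) => //; move: E; rewrite /l -kk => /eqP.
  by rewrite nth_uniq// -?/(l i) ?ls//; [move/eqP|rewrite ffunE kk; have := rm i';
    rewrite ffunE].
- move=> r r' /set_mem[rm _] /set_mem[rm' _] /ffunP E; apply/ffunP => i.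
  by have := E i; rewrite !ffunE => /eqP; rewrite nth_uniq ?ls// => /eqP.
- move=> j [[jinj jl] jp].
  have mem i : j i \in l i by apply/lin.
  exists [ffun i => index (j i) (l i)]; last first.
    by apply/ffunP => i; rewrite !ffunE nth_index.
  split; first by move=> i; rewrite ffunE -ls index_mem.
  move=> i i' []; rewrite !ffunE => kk E; apply: jinj.
  rewrite -(nth_index 0%N (mem i)) -(nth_index 0%N (mem i')) E.
  by rewrite /l kk.
Qed.

Lemma esum_label_tuples k c (f : 'rV[R]_n -> \bar R) : (forall x, 0 <= f x)%E ->
  (\esum_(j in label_tuples k c) f (\row_i points c (j i)) =
   f (site k) * tuple_count k (site_counts k c))%E.
Proof.
move=> f0; have [e be] := label_tuples_bij k c.
rewrite -esum_rank_tuples// -(@reindex_esum _ _ _ _ _ e (fun=> f (site k)) be).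
apply: eq_esum => j [_ jp]; congr f.
by apply/rowP => i; rewrite !mxE.
Qed.

Definition lattice_config c := forall j, labels c j ->
  exists k : int, points c j = a * k%:~R.

(** Sums over sites become series over [nat], to which the results on nonnegative series and
    countable unions apply. Codes of no site contribute 0, and [pickle_inv] is injective where it is
    defined, so each site is counted once. *)
Definition lattice_term (f : 'rV[R]_n -> \bar R) (N : {ffun 'I_n -> int} -> \bar R)
    (m : nat) : \bar R :=
  if pickle_inv m is Some k then (f (site k) * N k)%E else 0%E.

(** On a lattice configuration the tuples of distinct labels split into disjoint classes according
    to their sites; [a] being nonzero makes the site indices unique. *)
Lemma esum_distinct_labels c (f : 'rV[R]_n -> \bar R) : lattice_config c ->
  (forall x, 0 <= f x)%E ->
  (\esum_(j in distinct_labels c n) f (\row_i points c (j i)) =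
   \sum_(0 <= m <oo) lattice_term f (fun k => tuple_count k (site_counts k c)) m)%E.
Proof.
move=> lc f0; pose J (m : nat) : set {ffun 'I_n -> nat} :=
  if pickle_inv m is Some k then label_tuples k c else set0.
have -> : distinct_labels c n = \bigcup_m J m.
  apply/seteqP; split => j; last first.
    by move=> [m _]; rewrite /J; case: pickle_inv => // k [].
  move=> [jinj jl].
  have /choice[k hk] : forall i, exists k : int, points c (j i) = a * k%:~R.
    by move=> i; exact: lc.
  exists (pickle [ffun i => k i]) => //; rewrite /J pickleK_inv; split => //.
  by move=> i; rewrite ffunE.
have tJ : trivIset setT J.
  move=> m m' _ _ [j []]; rewrite /J.
  case E: (pickle_inv m) => [k|//]; case E': (pickle_inv m') => [k'|//] [_ p] [_ p'].
  have := @pickle_invK {ffun 'I_n -> int} m; have := @pickle_invK {ffun 'I_n -> int} m'.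
  rewrite E E' /= => <- <-; congr pickle.
  apply/ffunP => i; have := p i; rewrite p' => /(mulfI (lt0r_neq0 a0)) /eqP.
  by rewrite eqr_int => /eqP.
rewrite nneseries_sum_bigcup//; apply: eq_eseriesr => m _; rewrite /J /lattice_term.
by case: pickle_inv => [k|]; [exact: esum_label_tuples|rewrite esum_set0].
Qed.

End label_tuples.

(** * Measurability and finiteness of the mean counts *)

Section mean_count.
Context {R : realType} d (T : measurableType d) (P : probability T R).
Variable u : {RV P >-> config_space R}.
Variables (n : nat) (a : R).
Hypothesis a0 : 0 < a.
Implicit Types (k : {ffun 'I_n -> int}).

Lemma measurable_npoints_eq (V : set R) m : measurable V -> bounded_set V ->
  measurable [set w | npoints V (u w) = m].
Proof.
move=> mV bV; rewrite -[X in measurable X]setTI.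
have : measurable ([set c | npoints V c = m] : set (config_space R)).
  by apply: sub_sigma_algebra; exists V, m.
exact: (measurable_funP u measurableT).
Qed.

Lemma bounded_itvcc (x y : R) : bounded_set [set` `[x, y]].
Proof.
exists (`|x| + `|y|); split; first exact: num_real.
move=> M xyM z /=; rewrite in_itv/= => /andP[xz zy]; apply: le_trans (ltW xyM).
have := ler_norm y; have := ler_norm (- x); rewrite normrN ler_norml => ? ?.
have := normr_ge0 x; have := normr_ge0 y => ? ?.
by apply/andP; split; lra.
Qed.

Lemma measurable_site_counts k v : measurable [set w | site_counts a k (u w) = v].
Proof.
rewrite (_ : mkset _ = \bigcap_(i in [set: 'I_n])
    [set w | npoints [set a * (k i)%:~R] (u w) = v i]); last first.
  apply/seteqP; split => w /=; first by move=> <- i _ /=; rewrite ffunE.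
  by move=> H; apply/ffunP => i; rewrite ffunE; exact: H.
apply: fin_bigcap_measurable; first exact: finite_finset.
move=> i _; apply: measurable_npoints_eq; first exact: measurable_set1.
by rewrite -set_itv1; exact: bounded_itvcc.
Qed.

(** Occupation vectors range over a countable type, so any preimage is a countable union of their
    level sets, whatever function is applied to them. *)
Lemma measurable_tuple_count k :
  measurable_fun setT (fun w => tuple_count k (site_counts a k (u w)) : \bar R).
Proof.
move=> _ Y mY; rewrite setTI.
rewrite (_ : _ @^-1` _ = \bigcup_m (if pickle_inv m is Some v then
    if `[< Y (tuple_count k v) >] then [set w | site_counts a k (u w) = v] else set0
  else set0)).
  apply: bigcupT_measurable => m; case: pickle_inv => [v|//].
  by case: ifP => // _; exact: measurable_site_counts.
apply/seteqP; split => w /=.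
  move=> Yw; exists (pickle (site_counts a k (u w))) => //.
  by rewrite pickleK_inv ifT//; exact/asboolP.
by move=> [m _]; case: pickle_inv => [v|//]; case: ifPn => // /asboolP ? /= ->.
Qed.

Definition mean_count k : \bar R := (\int[P]_w tuple_count k (site_counts a k (u w)))%E.

Lemma mean_count_ge0 k : (0 <= mean_count k)%E.
Proof. by apply: integral_ge0 => w _; exact: tuple_count_ge0. Qed.

Lemma npointsS (V W : set R) (c : configuration R) : V `<=` W -> bounded_set W ->
  (npoints V c <= npoints W c)%N.
Proof.
move=> VW bW; apply: fsubset_leq_card.
have finW := locally_finite c bW.
have sub : labels c `&` points c @^-1` V `<=` labels c `&` points c @^-1` W.
  by move=> l [? ?]; split => //; exact: VW.
by rewrite -fset_set_sub//; exact: sub_finite_set finW.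
Qed.

Lemma measurable_npointsX (V : set R) e : measurable V -> bounded_set V ->
  measurable_fun setT (fun w => (npoints V (u w))%:R ^+ e : R).
Proof.
move=> mV bV _ Y mY; rewrite setTI.
rewrite (_ : _ @^-1` _ = \bigcup_m (if `[< Y (m%:R ^+ e) >] then
   [set w | npoints V (u w) = m] else set0)).
  apply: bigcupT_measurable => m; case: ifP => // _.
  exact: measurable_npoints_eq.
apply/seteqP; split => w /=.
  move=> Yw; exists (npoints V (u w)) => //.
  by rewrite ifT//; exact/asboolP.
by move=> [m _]; case: ifPn => // /asboolP ? /= ->.
Qed.

(** Each site is the left end of a unit interval, so the n-th powers of its occupation numbers are
    bounded by those of the interval counts, whose means [ulm] bounds. *)
Lemma mean_count_lty k : (0 < n)%N -> ulm u -> (mean_count k < +oo)%E.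
Proof.
move=> n0 ulmu; have [C HC] := ulmu n n0.
pose V i : set R := [set` `[a * (k i)%:~R, a * (k i)%:~R + 1]].
have mV i : measurable (V i) by exact: measurable_itv.
have bV i : bounded_set (V i) by exact: bounded_itvcc.
pose X i w : \bar R := ((npoints (V i) (u w))%:R ^+ n)%:E.
have mX i : measurable_fun setT (X i).
  by apply/measurable_EFinP; exact: measurable_npointsX.
have X0 i w : (0 <= X i w)%E by rewrite lee_fin exprn_ge0.
apply: (@le_lt_trans _ _ (\int[P]_w \sum_(i < n) X i w)%E).
  apply: ge0_le_integral => //.
  - by move=> w _; exact: tuple_count_ge0.
  - exact: measurable_tuple_count.
  - by apply: emeasurable_sum => i.
  - move=> w _; apply: (le_trans (tuple_count_le _ _ n0)).
    rewrite sumEFin lee_fin; apply: ler_sum => i _; rewrite lerXn2r ?nnegrE// ler_nat ffunE.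
    apply: npointsS => // x ->; rewrite /V /= in_itv/= lexx lerDl ler01//.
rewrite ge0_integral_sum//; apply: lte_sum_pinfty => i _.
have := HC (a * (k i)%:~R); rewrite unlock => /le_lt_trans; apply.
by rewrite ltry.
Qed.

(** For an arbitrary [f] the distinct sum is not known to be a measurable function of [w]. Off a
    null set it equals a difference of two measurable series [A], and finiteness of both means
    allows the integral of the difference to be split. *)
Lemma Edistinct_sum_lattice (f : 'rV[R]_n -> R) :
  supported_on_lattice a u ->
  (\sum_(0 <= m <oo) lattice_term a (EFin \o f)^\+ mean_count m < +oo)%E ->
  (\sum_(0 <= m <oo) lattice_term a (EFin \o f)^\- mean_count m < +oo)%E ->
  Edistinct_sum u f =
  (\sum_(0 <= m <oo) lattice_term a (EFin \o f)^\+ mean_count m -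
   \sum_(0 <= m <oo) lattice_term a (EFin \o f)^\- mean_count m)%E.
Proof.
move=> [N [mN N0 subN]] fp fn.
pose A (g : 'rV[R]_n -> \bar R) w : \bar R := (\sum_(0 <= m <oo)
   lattice_term a g (fun k => tuple_count k (site_counts a k (u w))) m)%E.
have t0 (g : 'rV[R]_n -> \bar R) w m : (forall x, 0 <= g x)%E ->
   (0 <= lattice_term a g (fun k => tuple_count k (site_counts a k (u w))) m)%E.
  move=> g0; rewrite /lattice_term; case: pickle_inv => // k.
  by rewrite mule_ge0// tuple_count_ge0.
have mt (g : 'rV[R]_n -> \bar R) m : measurable_fun setT (fun w =>
    lattice_term a g (fun k => tuple_count k (site_counts a k (u w))) m).
  rewrite /lattice_term; case: pickle_inv => [k|]; last exact: measurable_cst.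
  by apply: emeasurable_funM => //; exact: measurable_tuple_count.
have mA (g : 'rV[R]_n -> \bar R) : (forall x, 0 <= g x)%E -> measurable_fun setT (A g).
  by move=> g0; apply: ge0_emeasurable_sum => // *; exact: t0.
have iA (g : 'rV[R]_n -> \bar R) : (forall x, 0 <= g x)%E ->
   (\int[P]_w A g w = \sum_(0 <= m <oo) lattice_term a g mean_count m)%E.
  move=> g0; rewrite integral_nneseries//; last by move=> *; exact: t0.
  apply: eq_eseriesr => m _; rewrite /lattice_term; case: pickle_inv => [k|].
    rewrite ge0_integralZl//; last by move=> *; exact: tuple_count_ge0.
    exact: measurable_tuple_count.
  by rewrite integral0.
have p0 x : (0 <= (EFin \o f)^\+ x)%E by exact: funepos_ge0.
have n0 x : (0 <= (EFin \o f)^\- x)%E by exact: funeneg_ge0.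
have A0 (g : 'rV[R]_n -> \bar R) w : (forall x, 0 <= g x)%E -> (0 <= A g w)%E.
  by move=> g0; apply: nneseries_ge0 => *; exact: t0.
have intA (g : 'rV[R]_n -> \bar R) : (forall x, 0 <= g x)%E ->
   (\sum_(0 <= m <oo) lattice_term a g mean_count m < +oo)%E ->
   P.-integrable setT (A g).
  move=> g0 goo; apply/integrableP; split; first exact: mA.
  by under eq_integral do rewrite gee0_abs ?A0//; rewrite iA.
have -> : Edistinct_sum u f = (\int[P]_w (A (EFin \o f)^\+ w - A (EFin \o f)^\- w))%E.
  apply: (eq_integral_null mN N0) => w Nw.
  have lw : lattice_config a (u w) by apply: contrapT => H; apply: Nw; exact: subN.
  rewrite /distinct_sum /A -!(esum_distinct_labels a0 lw)//.
  by congr (_ - _)%E; apply: eq_esum => j _; rewrite ?funeposE ?funenegE.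
by rewrite integralB ?iA//; exact: intA.
Qed.

End mean_count.

(** * The correlation measure and its uniqueness *)

Section lattice_measure.
Context {R : realType}.
Variables (n : nat) (a : R) (N : {ffun 'I_n -> int} -> {nonneg R}).
Hypothesis a0 : 0 < a.

Definition lattice_atom (m : nat) : {measure set (borel_rV R n) -> \bar R} :=
  if pickle_inv m is Some k
  then mscale (N k) (dirac (site a k : borel_rV R n)) else mzero.

Definition lattice_measure : {measure set (borel_rV R n) -> \bar R} :=
  mseries lattice_atom 0.

Lemma ge0_integral_lattice_measure (f : borel_rV R n -> \bar R) :
  measurable_fun setT f -> (forall x, 0 <= f x)%E ->
  (\int[lattice_measure]_x f x =
   \sum_(0 <= m <oo) lattice_term a f (fun k => (N k)%:num%:E) m)%E.
Proof.
move=> mf f0; rewrite ge0_integral_measure_series//.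
apply: eq_eseriesr => m _; rewrite /lattice_atom /lattice_term.
case: pickle_inv => [k|]; last by rewrite integral_measure_zero.
by rewrite ge0_integral_mscale// integral_dirac// diracT mul1e muleC.
Qed.

Lemma lattice_measureC : lattice_measure (~` lattice_rV a n) = 0%E.
Proof.
apply: eseries0 => m _ _; rewrite /lattice_atom.
case: pickle_inv => [k|//]; rewrite /= /mscale /= diracE memNset ?mule0//.
by apply; move=> i; exists (k i); rewrite mxE.
Qed.

Lemma finite_bounded_sites (M : R) :
  finite_set [set k : {ffun 'I_n -> int} | forall i, `|a * (k i)%:~R| <= M].
Proof.
pose K := Num.truncn (M / a).
apply: (@sub_finite_set _ _
  ((fun t : {ffun 'I_n -> 'I_(K + K).+1} => [ffun i => (t i)%:Z - K%:Z]) @` setT)).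
  move=> k Mk.
  have kK i : (`|k i| <= K)%N.
    rewrite /K truncn_ge_nat//; last first.
      by apply: divr_ge0; [exact: le_trans (normr_ge0 _) (Mk i)|exact: ltW].
    rewrite ler_pdivlMr// (le_trans _ (Mk i))// normrM (gtr0_norm a0) mulrC.
    by rewrite ler_wpM2l ?(ltW a0)// natr_absz intr_norm.
  have shift_ge0 (z : int) (j : nat) : (`|z| <= j)%N -> 0 <= z + j%:Z by lia.
  have bd i : (absz (k i + K%:Z)%R < (K + K).+1)%N by have := kK i; lia.
  exists [ffun i => Ordinal (bd i)] => //.
  apply/ffunP => i; rewrite !ffunE /=; have Ki := kK i.
  by rewrite gez0_abs ?addrK//; exact: shift_ge0.
by apply: finite_image; exact: finite_finset.
Qed.

End lattice_measure.

Section summable.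
Context {R : realType}.
Variables (n : nat) (a : R).
Hypothesis a0 : 0 < a.

(** Only finitely many sites lie in the ball outside which [f] vanishes, so the series is a finite
    sum of finite terms. *)
Lemma lattice_term_lty (f : 'rV[R]_n -> \bar R) (N : {ffun 'I_n -> int} -> \bar R) (M : R) :
  (forall x, 0 <= f x < +oo)%E -> (forall k, 0 <= N k < +oo)%E ->
  (forall x, M < `|x| -> f x = 0%E) ->
  (\sum_(0 <= m <oo) lattice_term a f N m < +oo)%E.
Proof.
move=> f0 N0 fM.
have t0 m : (0 <= lattice_term a f N m < +oo)%E.
  rewrite /lattice_term; case: pickle_inv => [k|]; last by rewrite lexx ltry.
  have /andP[? ?] := f0 (site a k); have /andP[? ?] := N0 k.
  by rewrite mule_ge0//= lte_mul_pinfty// ge0_fin_numE.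
have tge0 m : (0 <= lattice_term a f N m)%E by have /andP[] := t0 m.
rewrite nneseries_esumT//.
pose S := @pickle {ffun 'I_n -> int} @`
  [set k : {ffun 'I_n -> int} | forall i, `|a * (k i)%:~R| <= M].
have finS : finite_set S by apply: finite_image; exact: finite_bounded_sites.
rewrite (_ : esum _ _ = \esum_(m in S) lattice_term a f N m).
  rewrite esum_fset// fsbig_finite//=; apply: lte_sum_pinfty => m _.
  by have /andP[] := t0 m.
rewrite [RHS]esum_mkcond; apply: eq_esum => m _; case: ifPn => // /negP mS.
rewrite /lattice_term; case E: pickle_inv => [k|//].
rewrite fM ?mul0e// ltNge; apply/negP => sM; apply: mS; rewrite inE.
exists k; last by have := @pickle_invK {ffun 'I_n -> int} m; rewrite E.
move=> i /=; apply: le_trans sM; rewrite [leRHS]/Num.Def.normr/= mx_normrE.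
by apply: le_trans (le_bigmax _ _ (ord0, i)); rewrite mxE.
Qed.

Lemma lattice_term1 (f : 'rV[R]_n -> \bar R) (N : {ffun 'I_n -> int} -> \bar R) k :
  (forall x, 0 <= f x)%E -> (forall k, 0 <= N k)%E ->
  (forall k', k' != k -> f (site a k') = 0%E) ->
  (\sum_(0 <= m <oo) lattice_term a f N m = f (site a k) * N k)%E.
Proof.
move=> f0 N0 fk.
have t0 m : (0 <= lattice_term a f N m)%E.
  by rewrite /lattice_term; case: pickle_inv => [k'|//]; rewrite mule_ge0.
rewrite nneseries_esumT// (_ : esum _ _ = \esum_(m in [set pickle k]) lattice_term a f N m).
  by rewrite esum_set1// /lattice_term pickleK_inv.
rewrite [RHS]esum_mkcond; apply: eq_esum => m _; case: ifPn => // /negP mk.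
rewrite /lattice_term; case E: pickle_inv => [k'|//].
rewrite fk ?mul0e//; apply/eqP => kk; apply: mk; rewrite inE/=.
by have := @pickle_invK {ffun 'I_n -> int} m; rewrite E kk.
Qed.

End summable.

Section rV_continuous.
Context {R : realType} {n : nat}.
Implicit Types f g : 'rV[R]_n -> R.

Lemma rV_continuous_cst (r : R) : continuous (fun _ : 'rV[R]_n => r).
Proof. exact: cst_continuous. Qed.

Lemma rV_continuousM f g : continuous f -> continuous g -> continuous (fun x => f x * g x).
Proof. by move=> cf cg x; exact: (@cvgM _ _ _ (nbhs_filter x) _ _ _ _ (cf x) (cg x)). Qed.

Lemma rV_continuousB f g : continuous f -> continuous g -> continuous (fun x => f x - g x).
Proof. by move=> cf cg x; exact: (@cvgB _ _ _ _ (nbhs_filter x) _ _ _ _ (cf x) (cg x)). Qed.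

Lemma rV_continuous_min f g : continuous f -> continuous g ->
  continuous (fun x => Num.min (f x) (g x)).
Proof. by move=> cf cg x; exact: (@continuous_min R _ f g x (cf x) (cg x)). Qed.

Lemma rV_continuous_max f g : continuous f -> continuous g ->
  continuous (fun x => Num.max (f x) (g x)).
Proof. by move=> cf cg x; exact: (@continuous_max R _ f g x (cf x) (cg x)). Qed.

End rV_continuous.

(** * Approximation of open sets by compactly supported continuous functions *)

Section open_approximation.
Context {R : realType}.
Variables (n : nat) (U : set 'rV[R]_n).
Hypothesis oU : open U.
Implicit Types (x y z : 'rV[R]_n).

(* The element 1 keeps the infimum meaningful when U is the whole space. *)
Definition dist_set x : set R := [set r | r = 1 \/ exists2 y, ~ U y & r = `|x - y|].

Definition dist_compl x : R := inf (dist_set x).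

Lemma has_inf_dist x : has_inf (dist_set x).
Proof.
split; first by exists 1; left.
by exists 0 => r [->//|[y _ ->]]; rewrite normr_ge0.
Qed.

Lemma dist_compl_ge0 x : 0 <= dist_compl x.
Proof.
apply: lb_le_inf; first by exists 1; left.
by move=> r [->//|[y _ ->]]; rewrite normr_ge0.
Qed.

Lemma dist_compl_lip x z : dist_compl x <= `|x - z| + dist_compl z.
Proof.
rewrite -lerBlDl; apply: lb_le_inf; first by exists 1; left.
move=> r [->|[y Uy ->]]; rewrite lerBlDl.
  have : dist_compl x <= 1 by apply: ge_inf; [exact: (has_inf_dist x).2|left].
  by move=> /le_trans; apply; rewrite lerDr.
have : dist_compl x <= `|x - y|.
  by apply: ge_inf; [exact: (has_inf_dist x).2|right; exists y].
by move=> /le_trans; apply; exact: ler_distD.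
Qed.

Lemma continuous_dist_compl : continuous dist_compl.
Proof.
move=> x; apply/(@cvgrPdist_le _ _ _ (nbhs x) (nbhs_filter x)) => e e0; near=> z.
have xz : `|x - z| <= e.
  near: z; apply/nbhs_ballP; exists e => //= y; rewrite -ball_normE; exact: ltW.
have := dist_compl_lip x z; have := dist_compl_lip z x; rewrite distrC => ? ?.
by rewrite ler_norml; apply/andP; split; lra.
Unshelve. all: by end_near. Qed.

Lemma dist_compl_out x : ~ U x -> dist_compl x = 0.
Proof.
move=> Ux; apply/eqP; rewrite eq_le dist_compl_ge0 andbT.
apply: ge_inf; first exact: (has_inf_dist x).2.
by right; exists x => //; rewrite subrr normr0.
Qed.

Lemma dist_compl_in x : U x -> 0 < dist_compl x.
Proof.
move=> Ux; have := oU; rewrite openE => /(_ _ Ux) /nbhs_ballP[e /= e0 eU].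
have m0 : 0 < Num.min 1 e by rewrite lt_min ltr01.
apply: (lt_le_trans m0); apply: lb_le_inf; first by exists 1; left.
move=> r [->|[y Uy ->]]; rewrite ge_min ?lexx//; apply/orP; right.
by rewrite leNgt; apply/negP => xy; apply: Uy; apply: eU; rewrite -ball_normE.
Qed.

(** The first factor increases to the indicator of [U]; the second truncates at radius [m], which
    makes the support compact, and increases to 1. *)
Definition open_approx (m : nat) x : R :=
  Num.min 1 (m%:R * dist_compl x) * Num.max 0 (Num.min 1 (m%:R - `|x|)).

Lemma open_approx_ge0 m x : 0 <= open_approx m x.
Proof.
by rewrite /open_approx mulr_ge0 ?le_max ?lexx// le_min ler01 mulr_ge0 ?dist_compl_ge0.
Qed.

Lemma open_approx_continuous m : continuous (open_approx m).
Proof.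
apply: rV_continuousM.
  apply: rV_continuous_min; first exact: rV_continuous_cst.
  by apply: rV_continuousM; [exact: rV_continuous_cst|exact: continuous_dist_compl].
apply: rV_continuous_max; first exact: rV_continuous_cst.
apply: rV_continuous_min; first exact: rV_continuous_cst.
by apply: rV_continuousB; [exact: rV_continuous_cst|exact: norm_continuous].
Qed.

Lemma open_approx_support m x : m%:R < `|x| -> open_approx m x = 0.
Proof.
move=> mx; rewrite /open_approx (@min_r _ _ 1 (m%:R - `|x|)); last by lra.
by rewrite max_l ?mulr0//; lra.
Qed.

Lemma nondecreasing_open_approx x : nondecreasing_seq (open_approx ^~ x).
Proof.
move=> i j ij; have ijR : i%:R <= j%:R :> R by rewrite ler_nat.
rewrite /open_approx; apply: ler_pM.
- by rewrite le_min ler01 mulr_ge0 ?dist_compl_ge0.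
- by rewrite le_max lexx.
- by rewrite le_min ge_min lexx/= ge_min ler_wpM2r ?orbT ?dist_compl_ge0.
- rewrite ge_max le_max lexx/=; rewrite le_max; apply/orP; right.
  by rewrite le_min !ge_min lexx/= lerB// orbT.
Qed.

Lemma cvg_open_approx x : open_approx ^~ x @ \oo --> (\1_U x : R).
Proof.
apply: cvg_near_cst; near=> m; rewrite indicE; have [Ux|Ux] := pselect (U x); last first.
  by rewrite memNset// /open_approx dist_compl_out// mulr0 (min_r (x := 1))// mul0r.
rewrite mem_set// /open_approx.
have m1 : `|x| + 1 <= m%:R by near: m; exact: nbhs_infty_ger.
have m2 : (dist_compl x)^-1 <= m%:R by near: m; exact: nbhs_infty_ger.
rewrite (min_l (y := _ - _)); last by lra.
rewrite max_r// mulr1 min_l//.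
by rewrite -ler_pdivrMr ?dist_compl_in// mul1r.
Unshelve. all: by end_near. Qed.

Lemma compact_open_approx_support m : compact (closed_support (open_approx m)).
Proof.
apply: bounded_closed_compact; last exact: closed_closure.
exists m%:R; split; first exact: num_real.
move=> M mM x xS; apply: le_trans (ltW mM).
have cl : closed [set x : 'rV[R]_n | `|x| <= m%:R].
  rewrite (_ : mkset _ = (fun x : 'rV[R]_n => `|x|) @^-1` [set` `]-oo, m%:R]]).
    by apply: preimage_closed => [y _|]; [exact: norm_continuous|exact: interval_closed].
  by apply/seteqP; split => y /=; rewrite in_itv.
have := (closure_id _).1 cl; move: xS => + clE;
  rewrite -[X in _ -> X]/([set x : 'rV[R]_n | `|x| <= m%:R] x).
rewrite clE; apply: closureS => y /=; apply: contra_neqP => /negP.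
by rewrite -ltNge => /open_approx_support.
Qed.

End open_approximation.

Section measure_uniqueness.
Context {R : realType}.
Variable n : nat.
Variables rho rho' : {measure set (borel_rV R n) -> \bar R}.

(** Monotone convergence along [open_approx] gives equality on open sets. These form a generating
    class stable under intersection, and the balls exhaust the space with finite measure, so
    equality extends to all Borel sets. *)
Lemma measure_unique_compact_support :
  (forall phi : 'rV[R]_n -> R, continuous phi -> compact (closed_support phi) ->
    (\int[rho]_x (phi x)%:E = \int[rho']_x (phi x)%:E)%E) ->
  (forall M : R, (rho (ball (0%R : 'rV[R]_n) M : set (borel_rV R n)) < +oo)%E) ->
  forall A, measurable A -> rho A = rho' A.
Proof.
move=> H fin.
have rho_open (mu : {measure set (borel_rV R n) -> \bar R}) (U : set 'rV[R]_n) : open U ->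
  ((fun m => \int[mu]_x (open_approx U m x)%:E) @ \oo --> mu U)%E.
  move=> oU.
  have mU : measurable (U : set (borel_rV R n)) by exact: open_measurable_rV.
  have mapp m : measurable_fun setT (fun x : borel_rV R n => (open_approx U m x)%:E).
    by apply/measurable_EFinP; apply: continuous_measurable_rV;
      exact: open_approx_continuous.
  have g0 m (x : borel_rV R n) : setT x -> (0 <= (open_approx U m x)%:E)%E.
    by move=> _; rewrite lee_fin open_approx_ge0.
  have gnd (x : borel_rV R n) : setT x -> nondecreasing_seq (fun m => (open_approx U m x)%:E).
    by move=> _ i j ij; rewrite lee_fin; exact: nondecreasing_open_approx.
  have := @cvg_monotone_convergence _ _ _ mu setT measurableT
    (fun m x => (open_approx U m x)%:E) mapp g0 gnd.
  rewrite (eq_integral (fun x : borel_rV R n => (\1_(U : set (borel_rV R n)) x)%:E));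
    first by rewrite integral_indic ?setIT.
  move=> x _; apply: cvg_lim => //; apply: cvg_EFin; first exact: nearW.
  exact: cvg_open_approx.
pose B k : set (borel_rV R n) := ball (0 : 'rV[R]_n) k.+1%:R.
have oB k : open (B k : set 'rV[R]_n) by exact: ball_open.
have BT : \bigcup_k B k = setT.
  apply/seteqP; split => // x _; exists (Num.truncn `|x : 'rV[R]_n|) => //.
  by rewrite /B -ball_normE /= sub0r normrN; exact: truncnS_gt.
have eq_open U : open (U : set 'rV[R]_n) -> rho U = rho' U.
  move=> oU; have := rho_open rho U oU.
  have -> : (fun m => \int[rho]_x (open_approx U m x)%:E)%E =
      (fun m => \int[rho']_x (open_approx U m x)%:E)%E.
    apply/funext => m; apply: H; first exact: open_approx_continuous.
    exact: compact_open_approx_support.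
  by move=> /(cvg_unique _); apply=> //; exact: rho_open.
have Bfin k : (rho (B k) < +oo)%E by exact: fin.
exact: (@measure_unique _ R (borel_rV R n) (@open 'rV[R]_n) B (measurable_rVE n)
  (@openI _) oB BT rho rho' eq_open Bfin).
Qed.

End measure_uniqueness.

(** * Correlation measures of lattice processes *)

Section lattice_process.
Context {R : realType} d (T : measurableType d) (P : probability T R).
Variable u : {RV P >-> config_space R}.
Variables (n : nat) (a : R).
Hypotheses (a0 : 0 < a) (n0 : (0 < n)%N) (ulmu : ulm u) (latu : supported_on_lattice a u).

Lemma mean_count_fin (k : {ffun 'I_n -> int}) : (0 <= mean_count u a k < +oo)%E.
Proof. by rewrite mean_count_ge0/= mean_count_lty. Qed.

(** Only the values of [eta] on the lattice matter. The sign of [C] is unknown, so the series of the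
    positive and the negative part are computed separately and recombined, which is legitimate
    because the mean count is finite. *)
Lemma Edistinct_sum_site (eta : 'rV[R]_n -> R) (C : R) (k : {ffun 'I_n -> int}) :
  (forall j : 'I_n -> int, eta (\row_i (a * (j i)%:~R)) =
     if [forall i, j i == k i] then C else 0) ->
  Edistinct_sum u eta = (C%:E * mean_count u a k)%E.
Proof.
move=> etaE.
have eta_site k' : eta (site a k') = if k' == k then C else 0.
  rewrite etaE; congr (if _ then _ else _); apply/forallP/eqP => [kk|-> //].
  by apply/ffunP => i; exact/eqP.
have c0 k' : (0 <= mean_count u a k')%E by exact: mean_count_ge0.
have cfin : mean_count u a k \is a fin_num by rewrite ge0_fin_numE// mean_count_lty.
have Sp : (\sum_(0 <= m <oo) lattice_term a (EFin \o eta)^\+ (mean_count u a) m =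
    (maxe C%:E 0) * mean_count u a k)%E.
  rewrite (lattice_term1 (k := k))//; first by rewrite funeposE /= eta_site eqxx.
  by move=> k' /negbTE kk; rewrite funeposE /= eta_site kk maxxx.
have Sn : (\sum_(0 <= m <oo) lattice_term a (EFin \o eta)^\- (mean_count u a) m =
    (maxe (- C%:E) 0) * mean_count u a k)%E.
  rewrite (lattice_term1 (k := k))//; first by rewrite funenegE /= eta_site eqxx.
  by move=> k' /negbTE kk; rewrite funenegE /= eta_site kk ?oppr0 ?oppe0 maxxx.
have lty (x : R) : ((maxe x%:E 0) * mean_count u a k < +oo)%E.
  by rewrite -(fineK cfin) -EFin_max -EFinM ltry.
rewrite (Edistinct_sum_lattice a0 latu); last 2 first.
- by rewrite Sp lty.
- by rewrite Sn -EFinN lty.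
rewrite Sp Sn -(fineK cfin) -EFinN -!EFin_max -!EFinM.
rewrite -EFinB -mulrBl; congr (_ * _)%:E.
by rewrite /Order.max; case: ltP => ?; case: ltP => ?; lra.
Qed.

Lemma correlation_identity_lattice (N : {ffun 'I_n -> int} -> {nonneg R}) :
  (forall k, mean_count u a k = (N k)%:num%:E) ->
  correlation_identity u (lattice_measure a N).
Proof.
move=> cN phi cphi kphi.
have mphi : measurable_fun setT (EFin \o phi : borel_rV R n -> \bar R).
  by apply/measurable_EFinP; exact: continuous_measurable_rV.
have [M [_ HM]] := compact_bounded kphi.
have phi0 x : M + 1 < `|x| -> phi x = 0.
  move=> Mx; apply/eqP/negPn/negP => px; have : `|x| <= M + 1.
    by apply: HM; [rewrite ltrDl|apply: subset_closure].
  by rewrite leNgt Mx.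
have S (g : 'rV[R]_n -> \bar R) :
  (\sum_(0 <= m <oo) lattice_term a g (mean_count u a) m =
   \sum_(0 <= m <oo) lattice_term a g (fun k => (N k)%:num%:E) m)%E.
  by apply: eq_eseriesr => m _; rewrite /lattice_term; case: pickle_inv => // k; rewrite cN.
have Sp : (\sum_(0 <= m <oo) lattice_term a (EFin \o phi)^\+ (mean_count u a) m < +oo)%E.
  apply: (lattice_term_lty a0 _ mean_count_fin) => [x|x /phi0 px].
    by rewrite funepos_ge0/= funeposE -EFin_max ltry.
  by rewrite funeposE /= px maxxx.
have Sn : (\sum_(0 <= m <oo) lattice_term a (EFin \o phi)^\- (mean_count u a) m < +oo)%E.
  apply: (lattice_term_lty a0 _ mean_count_fin) => [x|x /phi0 px].
    by rewrite funeneg_ge0/= funenegE -EFinN -EFin_max ltry.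
  by rewrite funenegE /= px ?oppr0 ?oppe0 maxxx.
rewrite (Edistinct_sum_lattice a0)// [RHS]integralE !S.
by rewrite !ge0_integral_lattice_measure//;
  [exact: measurable_funeneg|exact: measurable_funepos].
Qed.

Lemma correlation_measure_lattice (N : {ffun 'I_n -> int} -> {nonneg R}) :
  (forall k, mean_count u a k = (N k)%:num%:E) ->
  correlation_measure u (lattice_measure a N).
Proof.
move=> cN; have id := correlation_identity_lattice cN; split => // rho' id' A mA.
(* Finiteness on balls is checked for the lattice measure: a ball contains finitely many sites, each
   of finite mass. *)
apply/esym; apply: measure_unique_compact_support mA => [phi cphi kphi|M].
  by rewrite -id// -id'.
have mB : measurable (ball (0 : 'rV[R]_n) M : set (borel_rV R n)).
  have [M0|M0] := ltP 0 M; first by apply: open_measurable_rV; exact: ball_open.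
  rewrite (_ : ball _ _ = set0); first exact: measurable0.
  apply/seteqP; split => // x; rewrite -ball_normE /= => /lt_le_trans /(_ M0).
  by rewrite normr_lt0.
have -> : lattice_measure a N (ball (0 : 'rV[R]_n) M : set (borel_rV R n)) =
    (\int[lattice_measure a N]_x (\1_(ball (0 : 'rV[R]_n) M : set (borel_rV R n)) x)%:E)%E.
  by rewrite integral_indic// setIT.
rewrite ge0_integral_lattice_measure//; last first.
  by apply/measurable_EFinP; exact: measurable_indic.
apply: (@lattice_term_lty _ _ _ a0 _ _ M) => [x|k|x Mx].
- by rewrite lee_fin ltry indicE ler0n.
- by rewrite lee_fin ltry ge0.
- rewrite indicE memNset// -ball_normE /= sub0r normrN => /lt_trans /(_ Mx).
  by rewrite ltxx.
Qed.

End lattice_process.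

Theorem theorem1p4 (R : realType) (a B : R)
    (d d' d'' : measure_display)
    (T : measurableType d) (T' : measurableType d') (T'' : measurableType d'')
    (P : probability T R) (P' : probability T' R) (P'' : probability T'' R)
    (u : {RV P >-> config_space R})
    (u' : {RV P' >-> config_space R}) (u'' : {RV P'' >-> config_space R}) :
  0 < a -> 1 / (2 * a) < B ->
  ulm u ->
  supported_on_lattice a u' -> mimics B u' u ->
  supported_on_lattice a u'' -> mimics B u'' u ->
  forall n : nat, (0 < n)%N ->
    exists rho : {measure set (borel_rV R n) -> \bar R},
      [/\ correlation_measure u' rho,
          correlation_measure u'' rho &
          rho (~` lattice_rV a n) = 0%E].
Proof.
move=> a0 aB _ lat' [_ ulm' mim'] lat'' [_ ulm'' mim''] n n0.
have [C C0 test] := @lattice_test_function _ a B n a0 aB.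
pose c (k : {ffun 'I_n -> int}) : R := fine (mean_count u' a k).
have c0 k : 0 <= c k by apply: fine_ge0; exact: mean_count_ge0.
pose N k : {nonneg R} := NngNum (c0 k).
have cN k : mean_count u' a k = (N k)%:num%:E.
  by rewrite /= fineK// ge0_fin_numE ?mean_count_ge0// mean_count_lty.
have eq_count (k : {ffun 'I_n -> int}) : mean_count u'' a k = mean_count u' a k.
  have [eta [sch supp etaE]] := test (fun i => k i).
  have [E' _] := mim' n (fun x => (eta x)%:C%C) n0 sch supp;
    have [E'' _] := mim'' n (fun x => (eta x)%:C%C) n0 sch supp.
  have := Edistinct_sum_site a0 n0 ulm' lat' etaE.
  have := Edistinct_sum_site a0 n0 ulm'' lat'' etaE.
  (* Both expectations equal that of [u], which is the only way in which [u] enters the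
     comparison. *)
  have -> : Edistinct_sum u'' eta = Edistinct_sum u' eta by rewrite -[LHS]E'' -[RHS]E'.
  rewrite !cN => -> /eqP; have cfin'' : mean_count u'' a k \is a fin_num.
    by rewrite ge0_fin_numE ?mean_count_ge0// mean_count_lty.
  (* Both counts are finite, so the identity between multiples of [C] descends to the reals, where
     [C] can be cancelled. *)
  rewrite -(fineK cfin'') -!EFinM eqe => /eqP /(mulfI C0) ->.
  by [].
exists (lattice_measure a N); split.
- exact: correlation_measure_lattice.
- by apply: correlation_measure_lattice => // k; rewrite eq_count.
- exact: lattice_measureC.
Qed.
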